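(* Let $\mathcal F$ be an Ore FS category with FS group $G$ and canonical actions $\alpha:G\curvearrowright Q$ and $\beta$ of $\mathcal F$. There exists an FS group $\tilde G$ (the FS group of some Ore FS category) which is a quotient of $G$ and for which the canonical group action is faithful. Namely, $G\twoheadrightarrow\tilde G$ is the quotient map $G\twoheadrightarrow G/\ker(\alpha)$, and $G/\ker(\alpha)$ is the FS group of the FS category $\mathcal F/\ker(\beta)$.
   Context: FS categories. A tree is a finite rooted planar binary tree in which each vertex has zero children (a leaf) or two children (an interior vertex); leaves are ordered from left to right and labelled $1,2,\dots$. $I$ is the one-vertex tree. For a non-empty set $S$ of colours, a coloured tree is a tree with a map from its interior vertices to $S$. A (coloured) forest is a finite list $f=(f_1,\dots,f_n)$ of coloured trees; it has $n$ roots, and its leaves are those of $f_1,\dots,f_n$ in order. If $f$ has as many leaves as $g$ has roots, $f\circ g$ (or $fg$) is obtained by gluing the $i$th tree of $g$ to the $i$th leaf of $f$; $f\otimes g$ is concatenation of lists. This gives a monoidal category $\mathrm{FS}\langle S\rangle$ with object set $\{1,2,3,\dots\}$ (a forest with $r$ roots and $l$ leaves is a morphism $l\to r$). A skein relation is a pair $(u,v)$ of coloured trees with the same number of leaves. For a set $R$ of skein relations, $\mathrm{FS}\langle S|R\rangle$ is the quotient of $\mathrm{FS}\langle S\rangle$ by the smallest equivalence relation containing $R$ and closed under $\circ$ and $\otimes$. An FS category is a category of this form (up to isomorphism); its morphisms are still called forests, and trees if they have one root. $\mathcal F$ is Ore if it is left-cancellative ($fg=fh\Rightarrow g=h$) and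 has common right-multiples (if $f,g$ have the same number of roots there are $h,k$ with $fh=gk$). FS group. For $\mathcal F$ Ore, its FS group $G$ is the set of classes $[t,s]$ of pairs of trees of $\mathcal F$ with the same number of leaves, modulo $(t,s)\sim(tp,sp)$ for forests $p$, with product determined by $[t,s][s,r]=[t,r]$. Canonical actions. A pointed tree of $\mathcal F$ is a pair $(t,j)$ with $t$ a tree of $\mathcal F$ and $j$ a leaf of $t$; $(t,j)\circ(s,k)$ is the pointed tree obtained by gluing the root of $s$ to the $j$th leaf of $t$, with distinguished leaf that of $s$. $Q$ is the quotient of the set of pointed trees by the equivalence relation generated by $(t,j)\sim(tf,j^f)$ for all forests $f$ composable with $t$, where $j^f$ is the first leaf of the $j$th tree of $f$; $[t,j]$ is the class of $(t,j)$. The canonical group action is $\alpha:G\curvearrowright Q$, $[t,s]\cdot[s,j]=[t,j]$. For a pointed tree, $\beta(t,j):Q\to Q$, $[s,k]\mapsto[(t,j)\circ(s,k)]$. For a forest $f$, $\beta(f):Q^{\mathrm{Root}(f)}\to Q^{\mathrm{Leaf}(f)}$ has component at a leaf $\ell$ of the $r$th tree $f_r$ given by $(q_r)_r\mapsto\beta(f_r,\ell)(q_r)$. $\mathcal F/\ker(\beta)$ denotes the set of forests of $\mathcal F$ modulo $f\sim f'$ iff $\beta(f)=\beta(f')$, with the induced operations $\circ$ and $\otimes$ (it is an FS category). *)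

(* Defs.v *)
From Stdlib Require Import Relations.
From Stdlib Require List.
From HB Require Import structures.
From mathcomp Require Import all_boot.
From mathcomp Require Import boolp classical_sets.

Set Implicit Arguments.
Unset Strict Implicit.
Unset Printing Implicit Defensive.

Local Open Scope quotient_scope.
Local Open Scope nat_scope.

Section EquivQuotient.
Variables (T : choiceType) (E : relation T) (hE : equivalence T E).

Definition equivb : rel T := fun x y => `[< E x y >].

Lemma equivb_refl : reflexive equivb.
Proof. by case: hE => r _ _ x; apply/asboolP. Qed.

Lemma equivb_sym : symmetric equivb.
Proof. by case: hE => _ _ s x y; apply/asboolP/asboolP; apply: s. Qed.

Lemma equivb_trans : transitive equivb.
Proof.
case: hE => _ t _ y x z /asboolP xy /asboolP yz.
by apply/asboolP; apply: t xy yz.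
Qed.

Definition equiv_of : equiv_rel T :=
  EquivRel equivb equivb_refl equivb_sym equivb_trans.

Definition equot := {eq_quot equiv_of}.

Lemma equotP (x y : T) : \pi_equot x = \pi_equot y <-> E x y.
Proof.
split=> [/eqmodP /asboolP //|h].
by apply/eqmodP/asboolP.
Qed.

Lemma equot_surj (q : equot) : exists x, q = \pi_equot x.
Proof. by exists (repr q); rewrite reprK. Qed.

End EquivQuotient.

Definition gen_equivalence T (R : relation T) :
    equivalence T (clos_refl_sym_trans T R) :=
  Build_equivalence T _ (rst_refl T R) (rst_trans T R) (rst_sym T R).

Inductive ctree (S : Type) := Leaf | Node of S & ctree S & ctree S.
Arguments Leaf {S}.

HB.instance Definition _ S := gen_eqMixin (ctree S).
HB.instance Definition _ S := gen_choiceMixin (ctree S).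

Section FreeForests.
Variable S : Type.
Implicit Types (t u : ctree S) (f g h : seq (ctree S)).

Fixpoint nleaves t : nat :=
  if t is Node _ l r then nleaves l + nleaves r else 1.

Definition fleaves f : nat := sumn (map nleaves f).

(* Glues the roots of [g], from left to right, to the leaves of [t];
   meaningful when [size g = nleaves t]. *)
Fixpoint graft t g : ctree S :=
  match t with
  | Leaf => head Leaf g
  | Node c l r =>
      Node c (graft l (take (nleaves l) g)) (graft r (drop (nleaves l) g))
  end.

Fixpoint glue f g : seq (ctree S) :=
  if f is t :: f' then graft t (take (nleaves t) g) :: glue f' (drop (nleaves t) g)
  else [::].

Lemma nleaves_gt0 t : 0 < nleaves t.
Proof. by elim: t => //= _ l hl r hr; rewrite addn_gt0 hl. Qed.

Lemma fleaves_cat f g : fleaves (f ++ g) = fleaves f + fleaves g.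
Proof. by rewrite /fleaves map_cat sumn_cat. Qed.

Lemma size_glue f g : size (glue f g) = size f.
Proof. by elim: f g => //= t f IH g; rewrite IH. Qed.

Lemma glue_neq0 f g : f != [::] -> glue f g != [::].
Proof. by case: f. Qed.

Lemma nleaves_graft t g : size g = nleaves t -> nleaves (graft t g) = fleaves g.
Proof.
elim: t g => [|c l IHl r IHr] g /= sg.
  by case: g sg => [|u [|]] //= _; rewrite /fleaves /= addn0.
rewrite IHl ?IHr ?size_drop ?sg ?addKn //; last first.
  by rewrite size_takel // sg leq_addr.
by rewrite -fleaves_cat cat_take_drop.
Qed.

Lemma fleaves_glue f g : size g = fleaves f -> fleaves (glue f g) = fleaves g.
Proof.
elim: f g => [|t f IH] g /=; first by case: g.
rewrite /fleaves /= -!/(fleaves _) => sg.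
rewrite nleaves_graft ?IH ?size_drop ?sg ?addKn //; last first.
  by rewrite size_takel // sg leq_addr.
by rewrite -fleaves_cat cat_take_drop.
Qed.

Lemma glue_cat f1 f2 g1 g2 : size g1 = fleaves f1 ->
  glue (f1 ++ f2) (g1 ++ g2) = glue f1 g1 ++ glue f2 g2.
Proof.
elim: f1 g1 => [|t f IH] g1 /=; first by case: g1.
rewrite /fleaves /= -/(fleaves _) => sg.
have le : nleaves t <= size g1 by rewrite sg leq_addr.
have -> : drop (nleaves t) (g1 ++ g2) = drop (nleaves t) g1 ++ g2.
  rewrite drop_cat; case: ltngtP le => // -> _.
  by rewrite subnn drop0 drop_size.
by rewrite takel_cat // IH // size_drop sg addKn.
Qed.

Lemma split_size f m n : size f = m + n ->
  exists f1 f2, [/\ f = f1 ++ f2, size f1 = m & size f2 = n].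
Proof.
move=> sf; exists (take m f), (drop m f); rewrite cat_take_drop.
by rewrite size_takel ?size_drop sf ?leq_addr // addKn.
Qed.

Lemma graft_glue t g h : size g = nleaves t -> size h = fleaves g ->
  graft t (glue g h) = graft (graft t g) h.
Proof.
elim: t g h => [|c l IHl r IHr] g h /= sg sh.
  case: g sg sh => [|u [|]] //= _; rewrite /fleaves /= addn0 => sh.
  by rewrite take_oversize // sh.
have [g1 [g2 [eg s1 s2]]] := split_size sg; move: sg sh; rewrite {}eg => sg.
rewrite fleaves_cat => /split_size [h1 [h2 [-> sh1 sh2]]].
rewrite /= glue_cat // !take_size_cat ?size_glue ?nleaves_graft //.
rewrite !drop_size_cat ?size_glue ?nleaves_graft //.
by rewrite -IHl // -IHr.
Qed.

Lemma glueA f g h : size g = fleaves f -> size h = fleaves g ->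
  glue f (glue g h) = glue (glue f g) h.
Proof.
elim: f g h => [|t f IH] g h //=.
rewrite {1}/fleaves /= -/(fleaves _) => sg.
have [g1 [g2 [eg s1 s2]]] := split_size sg; move: sg; rewrite {}eg => sg.
rewrite fleaves_cat => /split_size [h1 [h2 [-> sh1 sh2]]].
rewrite /= glue_cat // !take_size_cat ?size_glue ?nleaves_graft //.
rewrite !drop_size_cat ?size_glue ?nleaves_graft //.
by rewrite -IH // graft_glue.
Qed.

Lemma graft_leaves t : graft t (nseq (nleaves t) Leaf) = t.
Proof.
elim: t => //= c l IHl r IHr.
by rewrite nseqD take_size_cat ?drop_size_cat ?size_nseq // IHl IHr.
Qed.

Lemma glue_leaves f : glue f (nseq (fleaves f) Leaf) = f.
Proof.
elim: f => //= t f IH; rewrite /fleaves /= -/(fleaves _) nseqD.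
by rewrite take_size_cat ?drop_size_cat ?size_nseq // graft_leaves IH.
Qed.

Lemma glue_nseq_leaf f : glue (nseq (size f) Leaf) f = f.
Proof. by elim: f => //= t f IH; rewrite ?take0 drop0 IH. Qed.

(* The objects of a forest category being 1, 2, 3, ..., forests are
   non-empty lists. *)
Definition cforest := {f : seq (ctree S) | f != [::]}.

Implicit Types F G : cforest.

Definition mkforest f (hf : f != [::]) : cforest := exist _ f hf.

Definition tree_forest t : cforest := @mkforest [:: t] isT.

Definition fcomp F G : cforest :=
  mkforest (glue_neq0 (val G) (valP F)).

Lemma cat_neq0 f g : f != [::] -> f ++ g != [::].
Proof. by case: f. Qed.

Definition ftens F G : cforest :=
  mkforest (cat_neq0 (val G) (valP F)).

Definition skein (R : relation (ctree S)) : Prop :=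
  forall u v, R u v -> nleaves u = nleaves v.

Inductive skein_cong (R : relation (ctree S)) : relation cforest :=
| SkeinBase u v : R u v -> skein_cong R (tree_forest u) (tree_forest v)
| SkeinRefl F : skein_cong R F F
| SkeinSym F G : skein_cong R F G -> skein_cong R G F
| SkeinTrans G F H : skein_cong R F G -> skein_cong R G H -> skein_cong R F H
| SkeinComp F F' G G' :
    size (val G) = fleaves (val F) -> size (val G') = fleaves (val F') ->
    skein_cong R F F' -> skein_cong R G G' ->
    skein_cong R (fcomp F G) (fcomp F' G')
| SkeinTens F F' G G' : skein_cong R F F' -> skein_cong R G G' ->
    skein_cong R (ftens F G) (ftens F' G').

Lemma skein_cong_equiv R : equivalence cforest (skein_cong R).
Proof. by split; [exact: SkeinRefl|move=> F G H; exact: SkeinTrans|exact: SkeinSym]. Qed.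

End FreeForests.

(* The data of a strict monoidal category whose objects are the positive
   integers.  A morphism [f] goes from [leaf f] to [root f]; [comp f g] is
   meaningful when [root g = leaf f].  [one] is the identity of the object 1,
   and the identity of [n] is its [n]-th tensor power.  The axioms are not
   fields: they follow from [is_FS] (see [FS_theory]). *)
Record forestCat := ForestCat {
  mor :> choiceType;
  root : mor -> nat;
  leaf : mor -> nat;
  comp : mor -> mor -> mor;
  tens : mor -> mor -> mor;
  one : mor }.
Arguments root {_} _.
Arguments leaf {_} _.
Arguments comp {_} _ _.
Arguments tens {_} _ _.
Arguments one {_}.

Definition fcat_iso (C D : forestCat) (phi : C -> D) : Prop :=
  [/\ bijective phi,
      forall f, root (phi f) = root f /\ leaf (phi f) = leaf f,
      forall f g, root g = leaf f -> phi (comp f g) = comp (phi f) (phi g),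
      forall f g, phi (tens f g) = tens (phi f) (phi g)
    & phi one = one].

(* Operations on classes are computed on representatives; for a set of skein
   relations they do not depend on the choice as soon as they are composable. *)
Definition FS (S : Type) (R : relation (ctree S)) : forestCat :=
  let Q := equot (skein_cong_equiv R) in
  @ForestCat Q
    (fun f => size (val (repr f)))
    (fun f => fleaves (val (repr f)))
    (fun f g => \pi_Q (fcomp (repr f) (repr g)))
    (fun f g => \pi_Q (ftens (repr f) (repr g)))
    (\pi_Q (tree_forest Leaf)).

Definition is_FS (C : forestCat) : Prop :=
  exists (S : Type) (R : relation (ctree S)),
    [/\ inhabited S, skein R & exists phi : FS R -> C, fcat_iso phi].

Definition left_cancellative (C : forestCat) : Prop :=
  forall f g h : C, root g = leaf f -> root h = leaf f ->
    comp f g = comp f h -> g = h.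

Definition common_right_multiples (C : forestCat) : Prop :=
  forall f g : C, root f = root g ->
    exists h k : C,
      [/\ root h = leaf f, root k = leaf g & comp f h = comp g k].

Definition is_Ore (C : forestCat) : Prop :=
  left_cancellative C /\ common_right_multiples C.

Record FScat := MkFScat { fscat :> forestCat; FScatP : is_FS fscat }.
Record OreFScat := MkOreFScat { orefs :> FScat; OreFScatP : is_Ore orefs }.

Section ForestCat.
Variable C : forestCat.
Implicit Types (f g h t : C) (s : seq C).

Fixpoint tensl s : C :=
  match s with
  | [::] => one
  | [:: f] => f
  | f :: s' => tens f (tensl s')
  end.

Definition ident (n : nat) : C := tensl (nseq n one).

Definition is_tree f : bool := root f == 1.

Definition tree_list f s : Prop :=
  [/\ s != [::], all is_tree s & tensl s = f].

(* The unique list (f_1, ..., f_n) of trees of which [f] is the tensor product. *)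
Definition trees f : seq C := xget [:: f] (tree_list f).

Definition forest_shape f : seq nat := map leaf (trees f).

(* With roots and leaves numbered from 0, the first leaf of the [j]-th tree
   of [f]. *)
Definition first_leaf f (j : nat) : nat := sumn (take j (forest_shape f)).

End ForestCat.

Record forest_theory (C : forestCat) : Prop := {
  root_gt0 : forall f : C, 0 < root f;
  leaf_gt0 : forall f : C, 0 < leaf f;
  root_one : root (@one C) = 1;
  leaf_one : leaf (@one C) = 1;
  root_comp : forall f g : C, root g = leaf f -> root (comp f g) = root f;
  leaf_comp : forall f g : C, root g = leaf f -> leaf (comp f g) = leaf g;
  root_tens : forall f g : C, root (tens f g) = root f + root g;
  leaf_tens : forall f g : C, leaf (tens f g) = leaf f + leaf g;
  compA : forall f g h : C, root g = leaf f -> root h = leaf g ->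
    comp f (comp g h) = comp (comp f g) h;
  comp1 : forall f : C, comp f (ident C (leaf f)) = f;
  comp1l : forall f : C, comp (ident C (root f)) f = f;
  tensA : forall f g h : C, tens f (tens g h) = tens (tens f g) h;
  comp_tens : forall f g f' g' : C, root g = leaf f -> root g' = leaf f' ->
    comp (tens f f') (tens g g') = tens (comp f g) (comp f' g');
  tree_list_exists : forall f : C, exists s, tree_list f s;
  tree_list_unique : forall (f : C) s s', tree_list f s -> tree_list f s' -> s = s' }.

Section Presented.
Variables (S : Type) (R : relation (ctree S)).
Hypothesis hR : skein R.

Let tcong (t u : ctree S) := skein_cong R (tree_forest t) (tree_forest u).

Lemma skein_cong_size F G : skein_cong R F G ->
  size (val F) = size (val G) /\ fleaves (val F) = fleaves (val G).
Proof.
elim=> //= {F G}.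
- by move=> u v /hR; rewrite /fleaves /= => ->.
- by move=> F G _ [-> ->].
- by move=> G F H _ [-> ->] _ [-> ->].
- move=> F F' G G' h h' _ [e1 e2] _ [e3 e4].
  by rewrite !size_glue !fleaves_glue // e1 e4.
- move=> F F' G G' _ [e1 e2] _ [e3 e4].
  by rewrite !size_cat !fleaves_cat e1 e2 e3 e4.
Qed.

Lemma tcong_nleaves t u : tcong t u -> nleaves t = nleaves u.
Proof. by move=> /skein_cong_size [_]; rewrite /fleaves /= !addn0. Qed.

Lemma Forall2_skein_cong F G :
  List.Forall2 tcong (val F) (val G) -> skein_cong R F G.
Proof.
move: {-2}(val F) {-2}(val G) (erefl (val F)) (erefl (val G)) => f g eF eG H.
elim: H F G eF eG => [|t u f' g' tu H IH] F G eF eG.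
  by case: F eF => [[|? ?] hF].
case: f' g' H IH eF eG => [|a f'] [|b g'] H; try by inversion H.
  move=> _ eF eG; rewrite (_ : F = tree_forest t); last exact: val_inj.
  by rewrite (_ : G = tree_forest u); last exact: val_inj.
move=> IH eF eG.
pose F' : cforest S := @mkforest S (a :: f') isT.
pose G' : cforest S := @mkforest S (b :: g') isT.
rewrite (_ : F = ftens (tree_forest t) F'); last exact: val_inj.
rewrite (_ : G = ftens (tree_forest u) G'); last exact: val_inj.
by apply: SkeinTens => //; exact: IH.
Qed.

Lemma Forall2_take_drop (f g : seq (ctree S)) n : List.Forall2 tcong f g ->
  List.Forall2 tcong (take n f) (take n g) /\
  List.Forall2 tcong (drop n f) (drop n g).
Proof.
move=> H; elim: H n => [|t u f' g' tu H IH] [|n] //=; split=> //;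
  try (by constructor); try by case: (IH n).
by constructor => //; case: (IH n).
Qed.

Lemma Forall2_size (f g : seq (ctree S)) : List.Forall2 tcong f g ->
  size f = size g.
Proof. by elim=> //= *; congr _.+1. Qed.

Lemma Forall2_glue (f f' g g' : seq (ctree S)) :
  size g = fleaves f -> List.Forall2 tcong f f' -> List.Forall2 tcong g g' ->
  List.Forall2 tcong (glue f g) (glue f' g').
Proof.
move=> sg H; elim: H g g' sg => [|t u f1 f1' tu H IH] g g' //=.
rewrite /fleaves /= -/(fleaves _) => sg Hg.
have [H1 H2] := Forall2_take_drop (nleaves t) Hg.
rewrite -(tcong_nleaves tu); constructor; last first.
  by apply: IH => //; rewrite size_drop sg addKn.
have s1 : size (take (nleaves t) g) = nleaves t by rewrite size_takel // sg leq_addr.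
have s2 : size (take (nleaves t) g') = nleaves t by rewrite -(Forall2_size H1).
have ne1 : take (nleaves t) g != [::] by rewrite -size_eq0 s1 -lt0n nleaves_gt0.
have ne2 : take (nleaves t) g' != [::] by rewrite -size_eq0 s2 -lt0n nleaves_gt0.
set G := mkforest ne1; set G' := mkforest ne2.
have HG : skein_cong R G G' by apply: Forall2_skein_cong.
rewrite /tcong (_ : tree_forest (graft t _) = fcomp (tree_forest t) G); last first.
  by apply: val_inj => /=; rewrite [take _ (take _ _)]take_oversize ?s1.
rewrite (_ : tree_forest (graft u _) = fcomp (tree_forest u) G'); last first.
  by apply: val_inj => /=; rewrite [take _ (take _ _)]take_oversize // s2 (tcong_nleaves tu).
by apply: SkeinComp => //; rewrite /fleaves /= addn0 ?s1 ?s2 ?(tcong_nleaves tu).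
Qed.

Lemma skein_congP F G : skein_cong R F G -> List.Forall2 tcong (val F) (val G).
Proof.
elim=> {F G} /=.
- by move=> u v uv; constructor => //; exact: SkeinBase.
- by move=> F; elim: (val F) => [|t f IH]; constructor => //; exact: SkeinRefl.
- move=> F G _; elim=> [|t u f g tu _ IH]; constructor => //; exact: SkeinSym.
- move=> G F H _ FG _; move: (val H) => h; elim: FG h => [|t u f g tu _ IH] h gh.
    by inversion gh.
  inversion gh; subst; constructor; last exact: IH.
  exact: SkeinTrans tu _.
- by move=> F F' G G' sG _ _ IHF _ IHG; exact: Forall2_glue.
- move=> F F' G G' _ IHF _ IHG; elim: IHF => //= *; by constructor.
Qed.

Variables (C : forestCat) (phi : FS R -> C).
Hypothesis hphi : fcat_iso phi.

Let Q := equot (skein_cong_equiv R).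
Let psi (F : cforest S) : C := phi (\pi_Q F).

Lemma repr_cong F : skein_cong R (repr (\pi_Q F)) F.
Proof. by apply/(equotP (skein_cong_equiv R)); rewrite reprK. Qed.

Lemma psi_surj f : exists F, f = psi F.
Proof.
case: hphi => [[k _ kK]] _ _ _ _; exists (repr (k f)).
by rewrite /psi reprK kK.
Qed.

Lemma psi_eq F G : psi F = psi G <-> skein_cong R F G.
Proof.
case: hphi => [/bij_inj inj] _ _ _ _; rewrite -(equotP (skein_cong_equiv R)).
by rewrite /psi; split=> [/inj|->].
Qed.

Lemma root_psi F : root (psi F) = size (val F).
Proof.
case: hphi => _ h _ _ _; rewrite (h _).1 /=.
by case: (skein_cong_size (repr_cong F)).
Qed.

Lemma leaf_psi F : leaf (psi F) = fleaves (val F).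
Proof.
case: hphi => _ h _ _ _; rewrite (h _).2 /=.
by case: (skein_cong_size (repr_cong F)).
Qed.

Lemma comp_psi F G : size (val G) = fleaves (val F) ->
  comp (psi F) (psi G) = psi (fcomp F G).
Proof.
move=> sG; case: hphi => _ h hc _ _.
have [e1 e2] := skein_cong_size (repr_cong F).
have [e3 e4] := skein_cong_size (repr_cong G).
rewrite /psi -hc /=; last by rewrite e2 e3.
apply/psi_eq; apply: SkeinComp => //; try exact: repr_cong.
by rewrite e2 e3.
Qed.

Lemma tens_psi F G : tens (psi F) (psi G) = psi (ftens F G).
Proof.
case: hphi => _ _ _ ht _; rewrite /psi -ht /=; apply/psi_eq.
by apply: SkeinTens; exact: repr_cong.
Qed.

Lemma one_psi : one = psi (tree_forest Leaf).
Proof. by case: hphi. Qed.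

Lemma tensl_psi (f : seq (ctree S)) (hf : f != [::]) :
  tensl [seq psi (tree_forest t) | t <- f] = psi (mkforest hf).
Proof.
elim: f hf => // t [|u f] IH hf.
  by congr psi; exact: val_inj.
rewrite [LHS]/= -/(tensl _); move: (IH isT) => /= ->.
by rewrite tens_psi; congr psi; exact: val_inj.
Qed.

Lemma ident_psi n (hn : nseq n (@Leaf S) != [::]) : ident C n = psi (mkforest hn).
Proof. by rewrite -tensl_psi map_nseq -one_psi. Qed.

Lemma psi_trees s : all (@is_tree C) s ->
  exists ts, s = [seq psi (tree_forest t) | t <- ts].
Proof.
elim: s => [|f s IH] /=; first by exists [::].
case/andP=> /eqP hf /IH [ts ->].
have [[[|t [|? ?]] hF] ef] := psi_surj f; move: hf; rewrite ef root_psi //= => _.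
by exists (t :: ts) => /=; congr (_ :: _); congr psi; exact: val_inj.
Qed.

Lemma presented_theory : forest_theory C.
Proof.
split.
- move=> f; have [F ->] := psi_surj f; rewrite root_psi.
  by case: F => [[]].
- move=> f; have [F ->] := psi_surj f; rewrite leaf_psi.
  by case: F => [[|t ?]] //= _; rewrite /fleaves /= addn_gt0 nleaves_gt0.
- by rewrite one_psi root_psi.
- by rewrite one_psi leaf_psi.
- move=> f g; have [F ->] := psi_surj f; have [G ->] := psi_surj g.
  by rewrite root_psi leaf_psi => h; rewrite comp_psi // !root_psi /= size_glue.
- move=> f g; have [F ->] := psi_surj f; have [G ->] := psi_surj g.
  by rewrite root_psi leaf_psi => h; rewrite comp_psi // !leaf_psi /= fleaves_glue.
- move=> f g; have [F ->] := psi_surj f; have [G ->] := psi_surj g.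
  by rewrite tens_psi !root_psi /= size_cat.
- move=> f g; have [F ->] := psi_surj f; have [G ->] := psi_surj g.
  by rewrite tens_psi !leaf_psi /= fleaves_cat.
- move=> f g h; have [F ->] := psi_surj f; have [G ->] := psi_surj g.
  have [H ->] := psi_surj h.
  rewrite !root_psi !leaf_psi => h1 h2; rewrite !comp_psi //=; first last.
  + by rewrite size_glue.
  + by rewrite fleaves_glue.
  by congr psi; apply: val_inj; rewrite /= glueA.
- move=> f; have [F ->] := psi_surj f; rewrite leaf_psi.
  have hn : nseq (fleaves (val F)) (@Leaf S) != [::].
    by case: F => [[|t ?]] //= _; rewrite -size_eq0 size_nseq -lt0n
      /fleaves /= addn_gt0 nleaves_gt0.
  rewrite (ident_psi hn) comp_psi /= ?size_nseq //.
  by congr psi; apply: val_inj; rewrite /= glue_leaves.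
- move=> f; have [F ->] := psi_surj f; rewrite root_psi.
  have hn : nseq (size (val F)) (@Leaf S) != [::] by case: F => [[]].
  have hl n : fleaves (nseq n (@Leaf S)) = n by rewrite /fleaves map_nseq sumn_nseq mul1n.
  rewrite (ident_psi hn) comp_psi /= ?hl //.
  by congr psi; apply: val_inj; rewrite /= glue_nseq_leaf.
- move=> f g h; have [F ->] := psi_surj f; have [G ->] := psi_surj g.
  have [H ->] := psi_surj h; rewrite !tens_psi.
  by congr psi; apply: val_inj; rewrite /= catA.
- move=> f g f' g'; have [F ->] := psi_surj f; have [G ->] := psi_surj g.
  have [F' ->] := psi_surj f'; have [G' ->] := psi_surj g'.
  rewrite !root_psi !leaf_psi => h1 h2; rewrite !tens_psi !comp_psi //=; last first.
    by rewrite size_cat fleaves_cat h1 h2.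
  by rewrite tens_psi; congr psi; apply: val_inj; rewrite /= glue_cat.
- move=> f; have [[F hF] ->] := psi_surj f.
  exists [seq psi (tree_forest t) | t <- F]; split.
  + by case: F hF.
  + by apply/allP=> _ /mapP [t _ ->]; rewrite /is_tree root_psi.
  + exact: tensl_psi.
- move=> f s s' [ns /psi_trees [ts es] e] [ns' /psi_trees [ts' es'] e'].
  have hts : ts != [::] by move: ns; rewrite es; case: (ts).
  have hts' : ts' != [::] by move: ns'; rewrite es'; case: (ts').
  move: e'; rewrite -e es es' (tensl_psi hts) (tensl_psi hts').
  move=> /psi_eq /skein_congP /=; elim=> //= t u g g' tu _ ->.
  by congr (_ :: _); apply/psi_eq; exact: SkeinSym.
Qed.

End Presented.

Lemma FS_theory (C : FScat) : forest_theory C.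
Proof. by case: C => C [S [R [_ hR [phi hphi]]]] /=; exact: presented_theory hphi. Qed.

Section TreeDecomposition.
Variable C : FScat.
Let th := FS_theory C.
Implicit Types (f g h : C) (s : seq C).

Lemma tensl_cons f s : s != [::] -> tensl (f :: s) = tens f (tensl s).
Proof. by case: s. Qed.

Lemma tensl_cat s1 s2 : s1 != [::] -> s2 != [::] ->
  tensl (s1 ++ s2) = tens (tensl s1) (tensl s2).
Proof.
move=> n1 n2; elim: s1 n1 => // f [|g s1] IH _; first by rewrite cat1s tensl_cons.
rewrite cat_cons (@tensl_cons f (g :: s1)) // (@tensl_cons f ((g :: s1) ++ s2)) //.
by rewrite IH // (tensA th).
Qed.

Lemma root_tensl s : s != [::] -> root (tensl s) = sumn (map root s).
Proof.
elim: s => // f [|g s] IH _; first by rewrite /= addn0.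
by rewrite tensl_cons // (root_tens th) IH.
Qed.

Lemma leaf_tensl s : s != [::] -> leaf (tensl s) = sumn (map leaf s).
Proof.
elim: s => // f [|g s] IH _; first by rewrite /= addn0.
by rewrite tensl_cons // (leaf_tens th) IH.
Qed.

Lemma sumn_root_trees s : all (@is_tree C) s -> sumn (map root s) = size s.
Proof. by elim: s => //= f s IH /andP [/eqP -> /IH ->]. Qed.

Lemma treesP f : tree_list f (trees f).
Proof. by case: (tree_list_exists th f) => s /(xgetI [:: f]). Qed.

Lemma treesE f s : tree_list f s -> trees f = s.
Proof. by move=> h; apply: (tree_list_unique th) (treesP f) h. Qed.

Lemma size_trees f : size (trees f) = root f.
Proof.
by have [n a e] := treesP f; rewrite -[in RHS]e root_tensl // sumn_root_trees.
Qed.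

Lemma sumn_shape f : sumn (forest_shape f) = leaf f.
Proof. by have [n a e] := treesP f; rewrite -[in RHS]e leaf_tensl. Qed.

Lemma size_shape f : size (forest_shape f) = root f.
Proof. by rewrite size_map size_trees. Qed.

Lemma trees_tens f g : trees (tens f g) = trees f ++ trees g.
Proof.
apply: treesE; have [nf af ef] := treesP f; have [ng ag eg] := treesP g.
split; first by case: (trees f) nf.
  by rewrite all_cat af.
by rewrite tensl_cat // ef eg.
Qed.

Lemma trees_tensl s : s != [::] -> all (@is_tree C) s -> trees (tensl s) = s.
Proof. by move=> n a; apply: treesE. Qed.

Lemma first_leaf_lt f j : j < root f -> first_leaf f j < leaf f.
Proof.
move=> lt; rewrite -sumn_shape /first_leaf -{2}[forest_shape f](cat_take_drop j).
rewrite sumn_cat -[X in X < _]addn0 ltn_add2l.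
rewrite (drop_nth 0) ?size_shape //= addn_gt0.
by rewrite (nth_map one) ?size_trees // leaf_gt0.
Qed.

Lemma first_leaf0 f : first_leaf f 0 = 0.
Proof. by rewrite /first_leaf take0. Qed.

Lemma first_leaf_tens f g : first_leaf (tens f g) (root f) = leaf f.
Proof.
by rewrite /first_leaf /forest_shape trees_tens map_cat take_size_cat
  ?sumn_shape // size_map size_trees.
Qed.

Lemma forest_split f j : 0 < j < root f ->
  exists a b, f = tens a b /\ root a = j.
Proof.
case/andP=> j0 jr; have [n a e] := treesP f.
have st : size (take j (trees f)) = j by rewrite size_takel // size_trees ltnW.
have nt : take j (trees f) != [::] by rewrite -size_eq0 st -lt0n.
have nd : drop j (trees f) != [::] by rewrite -size_eq0 size_drop size_trees subn_eq0 -ltnNge.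
exists (tensl (take j (trees f))), (tensl (drop j (trees f))); split.
  by rewrite -tensl_cat // cat_take_drop e.
have ta : all (@is_tree C) (take j (trees f)).
  by move: a; rewrite -{1}[trees f](cat_take_drop j) all_cat => /andP [].
by rewrite root_tensl // sumn_root_trees.
Qed.

Lemma first_leaf_comp f g j : root g = leaf f -> j < root f ->
  first_leaf (comp f g) j = first_leaf g (first_leaf f j).
Proof.
move=> rg jr; have [->|j0] := posnP j; first by rewrite !first_leaf0.
have [a [b [ef ra]]] : exists a b, f = tens a b /\ root a = j.
  by apply: forest_split; rewrite j0.
move: rg; rewrite ef (leaf_tens th) => rg.
have [a' [b' [eg ra']]] : exists a' b', g = tens a' b' /\ root a' = leaf a.
  by apply: forest_split; rewrite rg (leaf_gt0 th) -{1}[leaf a]addn0 ltn_add2l (leaf_gt0 th).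
have rb' : root b' = leaf b by move: rg; rewrite eg (root_tens th) ra' => /addnI.
rewrite eg (comp_tens th) // -{1}ra -(root_comp th ra') first_leaf_tens.
by rewrite -ra first_leaf_tens -ra' first_leaf_tens (leaf_comp th).
Qed.

End TreeDecomposition.

Definition tree_pair (C : forestCat) :=
  {x : C * C | [&& is_tree x.1, is_tree x.2 & leaf x.1 == leaf x.2]}.

Definition pair_step (C : forestCat) : relation (tree_pair C) := fun x y =>
  exists2 p : C, root p = leaf (val x).1 &
    val y = (comp (val x).1 p, comp (val x).2 p).

Definition FSgroup (F : OreFScat) := equot (gen_equivalence (@pair_step F)).

HB.instance Definition _ F := Choice.on (FSgroup F).

Definition frac (F : OreFScat) (x : tree_pair F) : FSgroup F := \pi_(FSgroup F) x.

(* [t, s] [s, r] = [t, r] *)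
Definition is_frac_mul (F : OreFScat) (g h k : FSgroup F) : Prop :=
  exists x y z : tree_pair F,
    [/\ g = frac x, h = frac y, k = frac z, (val x).2 = (val y).1
      & val z = ((val x).1, (val y).2)].

(* The default value [g] is never used. *)
Definition frac_mul (F : OreFScat) (g h : FSgroup F) : FSgroup F :=
  xget g (is_frac_mul g h).

Lemma swap_subproof (C : forestCat) (x : tree_pair C) :
  let y := ((val x).2, (val x).1) in
  [&& is_tree y.1, is_tree y.2 & leaf y.1 == leaf y.2].
Proof. by case: x => [[t s]] /= /and3P [-> -> /eqP ->] /=. Qed.

Definition swap (C : forestCat) (x : tree_pair C) : tree_pair C :=
  exist _ ((val x).2, (val x).1) (swap_subproof x).

Definition frac_inv (F : OreFScat) (g : FSgroup F) : FSgroup F := frac (swap (repr g)).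

Section FSGroup.
Variable F : OreFScat.
Let C : FScat := F.
Let th := FS_theory C.
Implicit Types (x y z : tree_pair F) (t s r p q : F) (g h k : FSgroup F).

Lemma tree_pairP x :
  [/\ root (val x).1 = 1, root (val x).2 = 1 & leaf (val x).1 = leaf (val x).2].
Proof. by case: x => [[t s]] /= /and3P [/eqP ? /eqP ? /eqP]. Qed.

Lemma tree_pair_exists t s : root t = 1 -> root s = 1 -> leaf t = leaf s ->
  exists x : tree_pair F, val x = (t, s).
Proof.
move=> rt rs l.
have h : [&& is_tree (t, s).1, is_tree (t, s).2 & leaf (t, s).1 == leaf (t, s).2].
  by rewrite /is_tree /= rt rs l !eqxx.
by exists (exist _ (t, s) h).
Qed.

Lemma Ore_cancel t p q : root p = leaf t -> root q = leaf t ->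
  comp t p = comp t q -> p = q.
Proof. by case: (OreFScatP F) => h _; apply: h. Qed.

Lemma Ore_common t s : root t = root s -> exists p q,
  [/\ root p = leaf t, root q = leaf s & comp t p = comp s q].
Proof. by case: (OreFScatP F) => _; apply. Qed.

(* The explicit form of the generated equivalence. *)
Definition pair_eqv x y := exists p q,
  [/\ root p = leaf (val x).1, root q = leaf (val y).1,
      comp (val x).1 p = comp (val y).1 q & comp (val x).2 p = comp (val y).2 q].

Lemma pair_eqv_trans x y z : pair_eqv x y -> pair_eqv y z -> pair_eqv x z.
Proof.
have [_ _ lx] := tree_pairP x; have [_ _ ly] := tree_pairP y.
have [_ _ lz] := tree_pairP z.
move=> [p [q [rp rq e1 e2]]] [p' [q' [rp' rq' e3 e4]]].
have [a [b [ra rb e]]] : exists a b, [/\ root a = leaf q, root b = leaf p' & comp q a = comp p' b].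
  by apply: Ore_common; rewrite rq rp'.
have lpq : leaf p = leaf q by rewrite -(leaf_comp th rp) e1 (leaf_comp th).
have lpq' : leaf p' = leaf q' by rewrite -(leaf_comp th rp') e3 (leaf_comp th).
exists (comp p a), (comp q' b).
have E1 : root (comp p a) = root p by rewrite (root_comp th) // ra.
have E2 : root (comp q' b) = root q' by rewrite (root_comp th) // rb.
split; rewrite ?E1 ?E2 //.
- rewrite !(compA th) ?ra ?rb //.
  by rewrite e1 -e3 -!(compA th) ?ra ?rb // e.
- rewrite !(compA th) ?ra ?rb -?lx -?lz //.
  by rewrite e2 -e4 -!(compA th) ?ra ?rb -?ly // e.
Qed.

Lemma frac_eq x y : frac x = frac y <-> pair_eqv x y.
Proof.
rewrite /frac equotP; split.
- elim=> {x y} [x y [p rp e]|x|x y _ [p [q [? ? ? ?]]]|x y z _ h1 _ h2].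
  + have [_ _ lx] := tree_pairP x.
    exists p, (ident F (leaf p)); rewrite e /=.
    have ri : root (ident F (leaf p)) = leaf p.
      have n0 : nseq (leaf p) (@one F) != [::].
        by rewrite -size_eq0 size_nseq -lt0n (leaf_gt0 th).
      rewrite /ident (root_tensl n0) map_nseq sumn_nseq (root_one th).
      by rewrite mul1n.
    split=> //; first by rewrite (leaf_comp th).
      by rewrite -[in RHS](leaf_comp th rp) (comp1 th).
    by rewrite lx in rp; rewrite -[in RHS](leaf_comp th rp) (comp1 th).
  + by exists (ident F (leaf (val x).1)), (ident F (leaf (val x).1)); split => //;
      rewrite /ident root_tensl ?map_nseq ?sumn_nseq ?(root_one th) ?mul1n //
        -size_eq0 size_nseq -lt0n (leaf_gt0 th).
  + by exists q, p.
  + exact: pair_eqv_trans h1 h2.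
- move=> [p [q [rp rq e1 e2]]].
  have [tx sx lx] := tree_pairP x; have [ty sy ly] := tree_pairP y.
  have [z ez] : exists z : tree_pair F, val z = (comp (val x).1 p, comp (val x).2 p).
    by apply: tree_pair_exists; rewrite ?(root_comp th) ?(leaf_comp th) -?lx.
  apply: (@rst_trans _ _ _ z); first by apply: rst_step; exists p.
  by apply: rst_sym; apply: rst_step; exists q; rewrite // ez e1 e2.
Qed.

Lemma frac_surj g : exists x, g = frac x.
Proof. exact: equot_surj. Qed.

Lemma frac_comp x y p : root p = leaf (val x).1 ->
  val y = (comp (val x).1 p, comp (val x).2 p) -> frac y = frac x.
Proof. by move=> rp e; apply/esym/equotP; apply: rst_step; exists p. Qed.

(* Two fractions can be written as [t, s] and [s, r]. *)
Lemma frac_common g h : exists x y,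
  [/\ g = frac x, h = frac y & (val x).2 = (val y).1].
Proof.
have [x ->] := frac_surj g; have [y ->] := frac_surj h.
have [tx sx lx] := tree_pairP x; have [ty sy ly] := tree_pairP y.
have [p [q [rp rq e]]] : exists p q, [/\ root p = leaf (val x).2,
  root q = leaf (val y).1 & comp (val x).2 p = comp (val y).1 q].
  by apply: Ore_common; rewrite sx ty.
have [x' ex] : exists z : tree_pair F, val z = (comp (val x).1 p, comp (val x).2 p).
  by apply: tree_pair_exists; rewrite ?(root_comp th) ?(leaf_comp th) ?lx.
have [y' ey] : exists z : tree_pair F, val z = (comp (val y).1 q, comp (val y).2 q).
  by apply: tree_pair_exists; rewrite ?(root_comp th) ?(leaf_comp th) -?ly.
exists x', y'; split; rewrite ?ex ?ey //.
- by rewrite (frac_comp _ ex) // rp lx.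
- by rewrite (frac_comp _ ey).
Qed.

Lemma frac_mul_pair x y : (val x).2 = (val y).1 ->
  exists z, val z = ((val x).1, (val y).2).
Proof.
have [tx sx lx] := tree_pairP x; have [ty sy ly] := tree_pairP y => e.
by apply: tree_pair_exists => //; rewrite lx e.
Qed.

Lemma is_frac_mul_unique g h k k' :
  is_frac_mul g h k -> is_frac_mul g h k' -> k = k'.
Proof.
move=> [x [y [z [-> -> -> e ez]]]] [x' [y' [z' [h1 h2 -> e' ez']]]].
have [_ _ lx] := tree_pairP x; have [_ _ lx'] := tree_pairP x'.
have [_ _ ly] := tree_pairP y; have [_ _ ly'] := tree_pairP y'.
have [p [q [rp rq e1 e2]]] := (frac_eq x x').1 h1.
have [p' [q' [rp' rq' e3 e4]]] := (frac_eq y y').1 h2.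
have [a [b [ra rb eab]]] : exists a b, [/\ root a = leaf p, root b = leaf p' &
    comp p a = comp p' b].
  by apply: Ore_common; rewrite rp rp' lx e.
have lpq : leaf p = leaf q by rewrite -(leaf_comp th rp) e1 (leaf_comp th).
have lpq' : leaf p' = leaf q' by rewrite -(leaf_comp th rp') e3 (leaf_comp th).
have eq' : comp q a = comp q' b.
  apply: (@Ore_cancel (val x').2); rewrite ?(root_comp th) ?ra ?rb //; try by rewrite ?rq ?rq' ?lx' ?e'.
  rewrite (compA th) -?lx' ?ra // -e2 -(compA th) -?lx ?ra // eab e.
  by rewrite (compA th) ?rb // e3 -(compA th) ?rb // e'.
apply/frac_eq; exists (comp p a), (comp q a); rewrite ez ez' /=.
rewrite !(root_comp th) ?ra //; split=> //.
  by rewrite !(compA th) ?ra // e1.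
rewrite eab eq' !(compA th) -?ly -?ly' ?rb //; by rewrite e4.
Qed.

Lemma frac_mulE x y z : (val x).2 = (val y).1 -> val z = ((val x).1, (val y).2) ->
  frac_mul (frac x) (frac y) = frac z.
Proof.
move=> e ez; have h : is_frac_mul (frac x) (frac y) (frac z) by exists x, y, z.
by apply: is_frac_mul_unique (xgetI _ h) h.
Qed.

Lemma frac_diag x y : (val x).1 = (val x).2 -> (val y).1 = (val y).2 ->
  frac x = frac y.
Proof.
have [tx sx lx] := tree_pairP x; have [ty sy ly] := tree_pairP y => ex ey.
have [p [q [rp rq e]]] : exists p q, [/\ root p = leaf (val x).1,
  root q = leaf (val y).1 & comp (val x).1 p = comp (val y).1 q].
  by apply: Ore_common; rewrite tx ty.
by apply/frac_eq; exists p, q; rewrite -ex -ey.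
Qed.

Lemma one_pair_subproof : let x := (@one F, @one F) in
  [&& is_tree x.1, is_tree x.2 & leaf x.1 == leaf x.2].
Proof. by rewrite /is_tree /= (root_one th) !eqxx. Qed.

Definition frac_one : FSgroup F := frac (exist _ (one, one) one_pair_subproof).

Lemma frac_oneE x : (val x).1 = (val x).2 -> frac x = frac_one.
Proof. by move=> e; apply: frac_diag. Qed.

Lemma frac_mul1g : left_id frac_one (@frac_mul F).
Proof.
move=> g; have [x ->] := frac_surj g.
have [tx sx lx] := tree_pairP x.
have [y ey] := tree_pair_exists tx tx erefl.
rewrite -(@frac_oneE y) ?ey //; apply: frac_mulE; rewrite ey //=.
by case: (val x).
Qed.

Lemma frac_mulg1 : right_id frac_one (@frac_mul F).
Proof.
move=> g; have [x ->] := frac_surj g.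
have [tx sx lx] := tree_pairP x.
have [y ey] := tree_pair_exists sx sx erefl.
rewrite -(@frac_oneE y) ?ey //; apply: frac_mulE; rewrite ey //=.
by case: (val x).
Qed.

Lemma frac_mulVg : left_inverse frac_one (@frac_inv F) (@frac_mul F).
Proof.
move=> g; rewrite -{2}[g]reprK /frac_inv; set x := repr g.
have [tx sx lx] := tree_pairP x; have [y ey] := tree_pair_exists sx sx erefl.
by rewrite -(@frac_oneE y) ?ey //; apply: frac_mulE; rewrite ?ey.
Qed.

Lemma frac_mulgV : right_inverse frac_one (@frac_inv F) (@frac_mul F).
Proof.
move=> g; rewrite -{1}[g]reprK /frac_inv; set x := repr g.
have [tx sx lx] := tree_pairP x; have [y ey] := tree_pair_exists tx tx erefl.
by rewrite -(@frac_oneE y) ?ey //; apply: frac_mulE; rewrite ?ey.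
Qed.

Lemma frac_common3 g h k : exists x y z,
  [/\ g = frac x, h = frac y, k = frac z, (val x).2 = (val y).1
    & (val y).2 = (val z).1].
Proof.
have [x [y [-> -> e]]] := frac_common g h.
have [y' [z [ey -> e']]] := frac_common (frac y) k.
have [_ _ lx] := tree_pairP x; have [tx sx _] := tree_pairP x.
have [_ _ ly'] := tree_pairP y'; have [_ _ lz] := tree_pairP z.
have [_ _ ly] := tree_pairP y; have [tz sz _] := tree_pairP z.
have [p [q [rp rq e1 e2]]] := (frac_eq y y').1 ey.
have [x1 ex1] : exists x1 : tree_pair F, val x1 = (comp (val x).1 p, comp (val x).2 p).
  by apply: tree_pair_exists; rewrite ?(root_comp th) ?(leaf_comp th) // ?lx e.
have [ty sy _] := tree_pairP y.
have [y1 ey1] : exists y1 : tree_pair F, val y1 = (comp (val y).1 p, comp (val y).2 p).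
  by apply: tree_pair_exists; rewrite ?(root_comp th) ?(leaf_comp th) // -ly.
have [z1 ez1] : exists z1 : tree_pair F, val z1 = (comp (val z).1 q, comp (val z).2 q).
  by apply: tree_pair_exists; rewrite ?(root_comp th) ?(leaf_comp th) // -?lz -e' -ly'.
exists x1, y1, z1; rewrite ex1 ey1 ez1 /= e e2 e'; split => //.
- by rewrite (frac_comp _ ex1) // lx e.
- by rewrite (frac_comp _ ey1).
- by rewrite (frac_comp _ ez1) // -e' -ly'.
Qed.

Lemma frac_mulA : associative (@frac_mul F).
Proof.
move=> g h k; have [x [y [z [-> -> -> e1 e2]]]] := frac_common3 g h k.
have [a ea] := frac_mul_pair e1; have [b eb] := frac_mul_pair e2.
rewrite (frac_mulE e1 ea) (frac_mulE e2 eb).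
have e3 : (val x).2 = (val b).1 by rewrite eb.
have e4 : (val a).2 = (val z).1 by rewrite ea.
have [c ec] := frac_mul_pair e3.
by rewrite (frac_mulE e3 ec) (frac_mulE e4 (z := c)) // ec ea eb.
Qed.

End FSGroup.

HB.instance Definition _ (F : OreFScat) := isGroup.Build (FSgroup F)
  (@frac_mulA F) (@frac_mul1g F) (@frac_mulg1 F) (@frac_mulVg F) (@frac_mulgV F).

Definition ptree (C : forestCat) :=
  {x : C * nat | is_tree x.1 && (x.2 < leaf x.1)}.

Definition point_step (C : forestCat) : relation (ptree C) := fun x y =>
  exists2 f : C, root f = leaf (val x).1 &
    val y = (comp (val x).1 f, first_leaf f (val x).2).

Definition pspace (C : forestCat) := equot (gen_equivalence (@point_step C)).

HB.instance Definition _ C := Choice.on (pspace C).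

Definition pclass (C : forestCat) (x : ptree C) : pspace C := \pi_(pspace C) x.

(* [t, s] . [s, j] = [t, j] *)
Definition is_alpha (F : OreFScat) (g : FSgroup F) (q q' : pspace F) : Prop :=
  exists (x : tree_pair F) (y z : ptree F),
    [/\ g = frac x, q = pclass y, q' = pclass z, (val x).2 = (val y).1
      & val z = ((val x).1, (val y).2)].

(* The default value [q] is never used. *)
Definition alpha (F : OreFScat) (g : FSgroup F) (q : pspace F) : pspace F :=
  xget q (is_alpha g q).

Section Alpha.
Variable F : OreFScat.
Let C : FScat := F.
Let th := FS_theory C.
Implicit Types (w : tree_pair F) (x y z : ptree F) (t s p q : F).

Lemma ptreeP x : root (val x).1 = 1 /\ (val x).2 < leaf (val x).1.
Proof. by case: x => [[t j]] /= /andP [/eqP]. Qed.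

Lemma ptree_exists t j : root t = 1 -> j < leaf t ->
  exists x : ptree F, val x = (t, j).
Proof.
move=> rt jt; have h : is_tree (t, j).1 && ((t, j).2 < leaf (t, j).1).
  by rewrite /is_tree /= rt jt.
by exists (exist _ (t, j) h).
Qed.

Definition ptree_eqv x y := exists p q,
  [/\ root p = leaf (val x).1, root q = leaf (val y).1,
      comp (val x).1 p = comp (val y).1 q
    & first_leaf p (val x).2 = first_leaf q (val y).2].

Lemma ptree_eqv_trans x y z : ptree_eqv x y -> ptree_eqv y z -> ptree_eqv x z.
Proof.
have [_ jx] := ptreeP x; have [_ jy] := ptreeP y; have [_ jz] := ptreeP z.
move=> [p [q [rp rq e1 e2]]] [p' [q' [rp' rq' e3 e4]]].
have [a [b [ra rb e]]] : exists a b, [/\ root a = leaf q, root b = leaf p' & comp q a = comp p' b].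
  by apply: Ore_common; rewrite rq rp'.
have lpq : leaf p = leaf q by rewrite -(leaf_comp th rp) e1 (leaf_comp th).
have lpq' : leaf p' = leaf q' by rewrite -(leaf_comp th rp') e3 (leaf_comp th).
exists (comp p a), (comp q' b).
have E1 : root (comp p a) = root p by rewrite (root_comp th) // ra.
have E2 : root (comp q' b) = root q' by rewrite (root_comp th) // rb.
split; rewrite ?E1 ?E2 //.
- rewrite !(compA th) ?ra ?rb //.
  by rewrite e1 -e3 -!(compA th) ?ra ?rb // e.
- rewrite !(@first_leaf_comp C) ?ra ?rb ?rp ?rq' //.
  rewrite e2 -e4 -!(@first_leaf_comp C) ?ra ?rb ?rq ?rp' //.
  by rewrite e.
Qed.

Lemma root_ident n : 0 < n -> root (ident F n) = n.
Proof.
move=> n0; have nn : nseq n (@one F) != [::] by rewrite -size_eq0 size_nseq -lt0n.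
by rewrite /ident (root_tensl nn) map_nseq sumn_nseq (root_one th) mul1n.
Qed.

Lemma first_leaf_ident n j : 0 < n -> j <= n -> first_leaf (ident F n) j = j.
Proof.
move=> n0 jn; have nn : nseq n (@one F) != [::] by rewrite -size_eq0 size_nseq -lt0n.
rewrite /first_leaf /forest_shape /ident (trees_tensl nn) ?all_nseq; last first.
  by rewrite /is_tree (root_one th) eqxx orbT.
by rewrite map_nseq take_nseq // sumn_nseq (leaf_one th) mul1n.
Qed.

Lemma pclass_eq x y : pclass x = pclass y <-> ptree_eqv x y.
Proof.
rewrite /pclass equotP; split.
- elim=> {x y} [x y [p rp e]|x|x y _ [p [q [? ? ? ?]]]|x y z _ h1 _ h2].
  + have [_ jx] := ptreeP x; have [_ jy] := ptreeP y.
    move: jy; rewrite e /= (leaf_comp th) // => jy.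
    exists p, (ident F (leaf p)); rewrite e /= root_ident ?(leaf_gt0 th) //.
    rewrite (leaf_comp th) // first_leaf_ident ?(leaf_gt0 th) //; last exact: ltnW.
    by split => //; rewrite -[in RHS](leaf_comp th rp) (comp1 th).
  + by exists (ident F (leaf (val x).1)), (ident F (leaf (val x).1)); split => //;
      rewrite root_ident ?(leaf_gt0 th).
  + by exists q, p.
  + exact: ptree_eqv_trans h1 h2.
- move=> [p [q [rp rq e1 e2]]].
  have [tx jx] := ptreeP x; have [ty jy] := ptreeP y.
  have [z ez] : exists z : ptree F, val z = (comp (val x).1 p, first_leaf p (val x).2).
    apply: ptree_exists; rewrite ?(root_comp th) ?(leaf_comp th) //.
    by apply: (@first_leaf_lt C); rewrite rp.
  apply: (@rst_trans _ _ _ z); first by apply: rst_step; exists p.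
  by apply: rst_sym; apply: rst_step; exists q; rewrite // ez e1 e2.
Qed.

Lemma pclass_surj (u : pspace F) : exists x, u = pclass x.
Proof. exact: equot_surj. Qed.

Lemma pclass_comp x y p : root p = leaf (val x).1 ->
  val y = (comp (val x).1 p, first_leaf p (val x).2) -> pclass y = pclass x.
Proof. by move=> rp e; apply/esym/equotP; apply: rst_step; exists p. Qed.

Lemma is_alpha_unique g u v v' : @is_alpha F g u v -> is_alpha g u v' -> v = v'.
Proof.
move=> [x [y [z [-> -> -> e ez]]]] [x' [y' [z' [h1 h2 -> e' ez']]]].
have [_ _ lx] := tree_pairP x; have [_ _ lx'] := tree_pairP x'.
have [_ jy] := ptreeP y; have [_ jy'] := ptreeP y'.
have [p [q [rp rq e1 e2]]] := (frac_eq x x').1 h1.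
have [p' [q' [rp' rq' e3 e4]]] := (pclass_eq y y').1 h2.
have [a [b [ra rb eab]]] : exists a b, [/\ root a = leaf p, root b = leaf p' &
    comp p a = comp p' b].
  by apply: Ore_common; rewrite rp rp' lx e.
have lpq : leaf p = leaf q by rewrite -(leaf_comp th rp) e1 (leaf_comp th).
have lpq' : leaf p' = leaf q' by rewrite -(leaf_comp th rp') e3 (leaf_comp th).
have eq' : comp q a = comp q' b.
  apply: (@Ore_cancel F (val x').2); rewrite ?(root_comp th) ?ra ?rb //;
    try by rewrite ?rq ?rq' ?lx' ?e'.
  rewrite (compA th) -?lx' ?ra // -e2 -(compA th) -?lx ?ra // eab e.
  by rewrite (compA th) ?rb // e3 -(compA th) ?rb // e'.
apply/pclass_eq; exists (comp p a), (comp q a); rewrite ez ez' /=.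
rewrite !(root_comp th) ?ra //; split=> //.
  by rewrite !(compA th) ?ra // e1.
rewrite eab eq' !(@first_leaf_comp C) ?rb ?rp' ?rq' //.
by rewrite e4.
Qed.

Lemma alphaE w y z : (val w).2 = (val y).1 -> val z = ((val w).1, (val y).2) ->
  alpha (frac w) (pclass y) = pclass z.
Proof.
move=> e ez; have h : is_alpha (frac w) (pclass y) (pclass z) by exists w, y, z.
by apply: is_alpha_unique (xgetI _ h) h.
Qed.

Lemma alpha_common (g : FSgroup F) (u : pspace F) : exists w y,
  [/\ g = frac w, u = pclass y & (val w).2 = (val y).1].
Proof.
have [x ->] := frac_surj g; have [y ->] := pclass_surj u.
have [tx sx lx] := tree_pairP x; have [ty jy] := ptreeP y.
have [p [q [rp rq e]]] : exists p q, [/\ root p = leaf (val x).2,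
  root q = leaf (val y).1 & comp (val x).2 p = comp (val y).1 q].
  by apply: Ore_common; rewrite sx ty.
have [x' ex] : exists z : tree_pair F, val z = (comp (val x).1 p, comp (val x).2 p).
  by apply: tree_pair_exists; rewrite ?(root_comp th) ?(leaf_comp th) ?lx.
have [y' ey] : exists z : ptree F, val z = (comp (val y).1 q, first_leaf q (val y).2).
  apply: ptree_exists; rewrite ?(root_comp th) ?(leaf_comp th) //.
  by apply: (@first_leaf_lt C); rewrite rq.
exists x', y'; split; rewrite ?ex ?ey //.
- by rewrite (frac_comp _ ex) // rp lx.
- by rewrite (pclass_comp _ ey).
Qed.

Lemma alpha_pair w y : (val w).2 = (val y).1 ->
  exists z : ptree F, val z = ((val w).1, (val y).2).
Proof.
have [tw sw lw] := tree_pairP w; have [ty jy] := ptreeP y => e.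
by apply: ptree_exists; rewrite // lw e.
Qed.

Lemma alpha1 u : alpha (1%g : FSgroup F) u = u.
Proof.
have [y ->] := pclass_surj u; have [ty jy] := ptreeP y.
have [w ew] := tree_pair_exists ty ty erefl.
rewrite (_ : 1%g = frac w); last by apply/esym/frac_oneE; rewrite ew.
by apply: alphaE; rewrite ew //=; case: (val y).
Qed.

Lemma alphaM (g h : FSgroup F) u : alpha (g * h)%g u = alpha g (alpha h u).
Proof.
have [w [y [-> -> e]]] := alpha_common h u.
have [z ez] := alpha_pair e; rewrite (alphaE e ez).
have [v [z' [-> eu e']]] := alpha_common g (pclass z).
have [tw sw lw] := tree_pairP w; have [tv sv lv] := tree_pairP v.
have [ty jy] := ptreeP y.
have [p [q [rp rq e1 e2]]] := (pclass_eq z z').1 eu.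
move: rp e1 e2; rewrite ez /= => rp e1 e2.
have [w' ew'] : exists x : tree_pair F, val x = (comp (val w).1 p, comp (val w).2 p).
  by apply: tree_pair_exists; rewrite ?(root_comp th) ?(leaf_comp th) // -lw.
have [v' ev'] : exists x : tree_pair F, val x = (comp (val v).1 q, comp (val v).2 q).
  by apply: tree_pair_exists; rewrite ?(root_comp th) ?(leaf_comp th) // ?lv ?e'.
have [y' ey'] : exists x : ptree F, val x = (comp (val y).1 p, first_leaf p (val y).2).
  apply: ptree_exists; rewrite ?(root_comp th) ?(leaf_comp th) -?e -?lw //.
  by apply: (@first_leaf_lt C); rewrite rp lw e.
have fw : frac w' = frac w by apply: frac_comp ew'.
have fv : frac v' = frac v by apply: frac_comp ev'; rewrite lv e'.
have fy : pclass y' = pclass y by apply: pclass_comp ey'; rewrite -e -lw.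
have h1 : (val v').2 = (val w').1 by rewrite ev' ew' /= e' e1.
have [m em] := frac_mul_pair h1.
have h2 : (val m).2 = (val y').1 by rewrite em ew' ey' /= e.
have [r er] := alpha_pair h2.
rewrite -fw -fv -fy [(_ * _)%g](frac_mulE h1 em) (alphaE h2 er) eu.
have [z1 ez1] : exists x : ptree F, val x = (comp (val z').1 q, first_leaf q (val z').2).
  have [tz jz] := ptreeP z'.
  apply: ptree_exists; rewrite ?(root_comp th) ?(leaf_comp th) //.
  by apply: (@first_leaf_lt C); rewrite rq.
rewrite -(pclass_comp rq ez1); apply/esym/alphaE; first by rewrite ev' ez1 /= e'.
by rewrite er em ey' ez1 /= e2.
Qed.

End Alpha.

Definition alpha_ker (F : OreFScat) (g : FSgroup F) : Prop :=
  forall q, alpha g q = q.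

Definition faithful_action (F : OreFScat) : Prop :=
  forall g : FSgroup F, (forall q, alpha g q = q) -> g = 1%g.

Section KerAlpha.
Variable F : OreFScat.
Implicit Types g h k : FSgroup F.

Definition alpha_eqv g h : Prop := alpha_ker (g^-1 * h)%g.

Lemma alpha_eqvP g h : alpha_eqv g h <-> alpha g = alpha h.
Proof.
split=> [H|H u]; last by rewrite alphaM -H -alphaM mulVg alpha1.
by apply/funext => u; rewrite -[in LHS](H u) -alphaM mulgA mulgV mul1g.
Qed.

Lemma alpha_eqv_equiv : equivalence (FSgroup F) alpha_eqv.
Proof.
split=> [g|g h k /alpha_eqvP e /alpha_eqvP e'|g h /alpha_eqvP e]; apply/alpha_eqvP => //.
by rewrite e.
Qed.

Definition FSgroup_quot := equot alpha_eqv_equiv.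

HB.instance Definition _ := Choice.on FSgroup_quot.

Definition gclass g : FSgroup_quot := \pi_FSgroup_quot g.

Lemma gclass_eq g h : gclass g = gclass h <-> alpha g = alpha h.
Proof. by rewrite /gclass equotP; exact: alpha_eqvP. Qed.

Lemma repr_gclass g : alpha (repr (gclass g)) = alpha g.
Proof. by apply/gclass_eq; rewrite /gclass reprK. Qed.

Definition quot_mul (a b : FSgroup_quot) := gclass (repr a * repr b)%g.
Definition quot_inv (a : FSgroup_quot) := gclass (repr a)^-1%g.

Lemma gclassM g h : quot_mul (gclass g) (gclass h) = gclass (g * h)%g.
Proof. by apply/gclass_eq/funext => u; rewrite !alphaM !repr_gclass. Qed.

Lemma gclassV g : quot_inv (gclass g) = gclass g^-1%g.
Proof.
apply/gclass_eq/funext => u; rewrite -[in LHS](alpha1 u) -(mulgV g) alphaM.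
by rewrite -(repr_gclass g) -alphaM mulVg alpha1.
Qed.

Lemma gclass_surj (a : FSgroup_quot) : exists g, a = gclass g.
Proof. exact: equot_surj. Qed.

Lemma quot_mulA : associative quot_mul.
Proof.
move=> a b c; have [g ->] := gclass_surj a; have [h ->] := gclass_surj b.
by have [k ->] := gclass_surj c; rewrite !gclassM mulgA.
Qed.

Lemma quot_mul1g : left_id (gclass 1%g) quot_mul.
Proof. by move=> a; have [g ->] := gclass_surj a; rewrite gclassM mul1g. Qed.

Lemma quot_mulg1 : right_id (gclass 1%g) quot_mul.
Proof. by move=> a; have [g ->] := gclass_surj a; rewrite gclassM mulg1. Qed.

Lemma quot_mulVg : left_inverse (gclass 1%g) quot_inv quot_mul.
Proof. by move=> a; have [g ->] := gclass_surj a; rewrite gclassV gclassM mulVg. Qed.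

Lemma quot_mulgV : right_inverse (gclass 1%g) quot_inv quot_mul.
Proof. by move=> a; have [g ->] := gclass_surj a; rewrite gclassV gclassM mulgV. Qed.

HB.instance Definition _ := isGroup.Build FSgroup_quot
  quot_mulA quot_mul1g quot_mulg1 quot_mulVg quot_mulgV.

End KerAlpha.

HB.instance Definition _ (F : OreFScat) :=
  isMultiplicative.Build (FSgroup F) (FSgroup_quot F) (@gclass F)
    (fun g h => esym (gclassM g h)).

Section Beta.
Variable C : FScat.
Let th := FS_theory C.
Implicit Types (f : C) (x y : ptree C).

(* The root of [s] is glued to the leaf [j] of [t] by composing [t] with
   (I, ..., I, s, I, ..., I), where [s] is in position [j]. *)
Definition plug_val x y : C * nat :=
  let: (t, j) := val x in let: (s, k) := val y in
  (comp t (tensl (nseq j one ++ s :: nseq (leaf t - j.+1) one)), j + k).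

Lemma plug_subproof x y :
  is_tree (plug_val x y).1 && ((plug_val x y).2 < leaf (plug_val x y).1).
Proof.
case: x y => [[t j] /= /andP [/eqP rt jt]] [[s k] /= /andP [/eqP rs ks]].
rewrite /plug_val /=; set L := nseq j one ++ _.
have nL : L != [::] by rewrite /L; case: (j).
have rL : root (tensl L) = leaf t.
  rewrite root_tensl // map_cat sumn_cat /= !map_nseq !sumn_nseq (root_one th).
  by rewrite !mul1n rs add1n -addSnnS subnKC.
rewrite /is_tree (root_comp th) // rt eqxx (leaf_comp th) //=.
rewrite leaf_tensl // map_cat sumn_cat /= !map_nseq !sumn_nseq (leaf_one th).
by rewrite !mul1n ltn_add2l ltn_addr.
Qed.

Definition plug x y : ptree C := exist _ (plug_val x y) (plug_subproof x y).

Definition beta_pt x (q : pspace C) : pspace C := pclass (plug x (repr q)).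

Lemma comp_one : comp one one = one :> C.
Proof. by have := comp1 th one; rewrite (leaf_one th). Qed.

Lemma comp_ident n : 0 < n -> comp (ident C n) (ident C n) = ident C n.
Proof.
move=> n0; have nn : nseq n (@one C) != [::] by rewrite -size_eq0 size_nseq -lt0n.
have := comp1 th (ident C n); rewrite {2}/ident (leaf_tensl nn) map_nseq sumn_nseq.
by rewrite (leaf_one th) mul1n.
Qed.

Lemma comp_pad (s p : C) j m : root p = leaf s ->
  comp (tensl (nseq j one ++ s :: nseq m one))
       (tensl (nseq j one ++ trees p ++ nseq m one))
  = tensl (nseq j one ++ comp s p :: nseq m one).
Proof.
move=> rp; have [np ap ep] := treesP p; elim: j => [|j IH].
  rewrite !cat0s; case: m => [|m]; first by rewrite cats0 ep.
  rewrite tensl_cat // ep (@tensl_cons C s (nseq m.+1 one)) //.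
  rewrite (@tensl_cons C (comp s p) (nseq m.+1 one)) // (comp_tens th) //; last first.
    by rewrite root_tensl // leaf_tensl // !map_nseq (root_one th) (leaf_one th).
  by congr tens; exact: comp_ident.
have nA (a : C) : nseq j one ++ a :: nseq m one != [::] by case: (j).
have nB : nseq j one ++ trees p ++ nseq m one != [::].
  by move: np; case: (j) => //; case: (trees p).
have e : root (tensl (nseq j one ++ trees p ++ nseq m one)) =
         leaf (tensl (nseq j one ++ s :: nseq m one)).
  rewrite root_tensl // leaf_tensl // !map_cat !sumn_cat /= !map_nseq !sumn_nseq.
  by rewrite (root_one th) (leaf_one th) sumn_root_trees // size_trees rp.
rewrite [nseq j.+1 one]/= !cat_cons !tensl_cons //.
by rewrite (comp_tens th) ?(root_one th) ?(leaf_one th) // comp_one IH.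
Qed.

Lemma first_leaf_pad (p : C) j m k : k <= root p ->
  first_leaf (tensl (nseq j one ++ trees p ++ nseq m one)) (j + k)
  = j + first_leaf p k.
Proof.
move=> kp; have [np ap ep] := treesP p.
rewrite /first_leaf /forest_shape trees_tensl; first last.
- by rewrite !all_cat ap !all_nseq /is_tree (root_one th) !orbT.
- by move: np; case: (j) => //; case: (trees p).
rewrite !map_cat !map_nseq take_cat size_nseq ltnNge leq_addr /= addKn.
rewrite sumn_cat sumn_nseq (leaf_one th) mul1n takel_cat //.
by rewrite size_map size_trees.
Qed.

Lemma plug_step x y y' : point_step y y' -> pclass (plug x y) = pclass (plug x y').
Proof.
case=> p rp ey; apply/equotP; apply: rst_step.
have := valP x; case ex : (val x) => [t j] /= /andP [/eqP rt jt].
have := valP y; case ey0 : (val y) rp ey => [s k] /= rp ey'.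
move=> /andP [/eqP rs ks].
pose m := leaf t - j.+1; pose P := tensl (nseq j one ++ trees p ++ nseq m one).
pose A := tensl (nseq j one ++ s :: nseq m one).
have nA (a : C) : nseq j one ++ a :: nseq m one != [::] by case: (j).
have [np ap ep] := treesP p.
have nP : nseq j one ++ trees p ++ nseq m one != [::].
  by move: np; case: (j) => //; case: (trees p).
have rA : root A = leaf t.
  rewrite root_tensl // map_cat sumn_cat /= !map_nseq !sumn_nseq (root_one th).
  by rewrite !mul1n rs add1n -addSnnS subnKC.
have rP : root P = leaf A.
  rewrite root_tensl // leaf_tensl // !map_cat !sumn_cat /= !map_nseq !sumn_nseq.
  by rewrite (root_one th) (leaf_one th) sumn_root_trees // size_trees rp.
have e0 : plug_val x y = (comp t A, j + k) by rewrite /plug_val ex ey0.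
have e1 : plug_val x y' =
    (comp t (tensl (nseq j one ++ comp s p :: nseq m one)), j + first_leaf p k).
  by rewrite /plug_val ex (ey' : val y' = _).
exists P; rewrite [val (plug x y)]e0 ?[val (plug x y')]e1 /=.
  by rewrite (leaf_comp th).
rewrite -(compA th) // comp_pad //.
by rewrite first_leaf_pad // rp ltnW.
Qed.

Lemma beta_ptE x y : beta_pt x (pclass y) = pclass (plug x y).
Proof.
rewrite /beta_pt.
have : clos_refl_sym_trans _ (@point_step C) (repr (pclass y)) y.
  by apply/(equotP (gen_equivalence (@point_step C))); rewrite reprK.
move: (repr _) => z; elim=> {z y}.
- by move=> u v; exact: plug_step.
- by [].
- by move=> u v _ ->.
- by move=> u v w _ -> _ ->.
Qed.

Lemma leaf_root_subproof f (l : 'I_(leaf f)) :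
  reshape_index (forest_shape f) l < root f.
Proof. by rewrite -size_shape reshape_indexP // sumn_shape. Qed.

(* The leaf [l] of [f] is the leaf [reshape_offset (forest_shape f) l] of the
   tree of [f] of index [reshape_index (forest_shape f) l]. *)
Definition leaf_root f (l : 'I_(leaf f)) : 'I_(root f) :=
  Ordinal (leaf_root_subproof l).

Definition leaf_ptree_val f (l : 'I_(leaf f)) : C * nat :=
  (nth one (trees f) (leaf_root l), reshape_offset (forest_shape f) l).

Lemma leaf_ptree_subproof f (l : 'I_(leaf f)) :
  is_tree (leaf_ptree_val l).1 && ((leaf_ptree_val l).2 < leaf (leaf_ptree_val l).1).
Proof.
have rt : leaf_root l < size (trees f) by rewrite size_trees.
have [_ a _] := treesP f; rewrite (allP a) ?mem_nth //= -(nth_map one 0) //.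
by apply: reshape_offsetP; rewrite sumn_shape.
Qed.

Definition leaf_ptree f (l : 'I_(leaf f)) : ptree C :=
  exist _ (leaf_ptree_val l) (leaf_ptree_subproof l).

Definition beta f (q : 'I_(root f) -> pspace C) : 'I_(leaf f) -> pspace C :=
  fun l => beta_pt (leaf_ptree l) (q (leaf_root l)).

(* [beta f] together with its domain and codomain. *)
Definition beta_arrow f :
    {d : nat * nat & ('I_d.1 -> pspace C) -> ('I_d.2 -> pspace C)} :=
  existT _ (root f, leaf f) (@beta f).

Definition beta_eqv f f' : Prop := beta_arrow f = beta_arrow f'.

Lemma beta_eqv_equiv : equivalence C beta_eqv.
Proof. by split=> [f|f g h|f g] //; rewrite /beta_eqv => ->. Qed.

(* As for [FS], the operations are those induced by [C] on classes. *)
Definition FS_quot : forestCat :=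
  let Q := equot beta_eqv_equiv in
  @ForestCat Q
    (fun a => root (repr a))
    (fun a => leaf (repr a))
    (fun a b => \pi_Q (comp (repr a) (repr b)))
    (fun a b => \pi_Q (tens (repr a) (repr b)))
    (\pi_Q one).

Definition fclass f : FS_quot := \pi_(equot beta_eqv_equiv) f.

Lemma fclass_eq f f' : fclass f = fclass f' <-> beta_eqv f f'.
Proof. exact: equotP. Qed.

Lemma fclass_dom f : root (fclass f) = root f /\ leaf (fclass f) = leaf f.
Proof.
have : beta_eqv (repr (fclass f)) f by apply/fclass_eq; rewrite /fclass reprK.
by move=> /(congr1 (fun d => projT1 d)) /= [-> ->].
Qed.

Lemma pair_class_subproof (x : tree_pair C) :
  let y := (fclass (val x).1, fclass (val x).2) in
  [&& is_tree y.1, is_tree y.2 & leaf y.1 == leaf y.2].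
Proof.
case: x => [[t s] h]; change ([&& root (fclass t) == 1, root (fclass s) == 1
  & leaf (fclass t) == leaf (fclass s)]).
by have [-> ->] := fclass_dom t; have [-> ->] := fclass_dom s.
Qed.

Definition pair_class (x : tree_pair C) : tree_pair FS_quot :=
  exist _ (fclass (val x).1, fclass (val x).2) (pair_class_subproof x).

End Beta.

(* Main.v *)
Require Import Defs.
From Stdlib Require List.
From HB Require Import structures.
From mathcomp Require Import all_boot.
From mathcomp Require Import boolp.
(* Imported again so that [root] denotes the number of roots of a forest and
   not [fingraph.root]. *)
Import Defs.

(** Two forests f, f' have the same image under beta if and only if
    they have as many roots and leaves and [f p, k] = [f' p, k] for all p and k,
    where the relation defining Q is extended to pointed forests.  In this form
    compatibility with composition and left-cancellativity are immediate, and
    compatibility with tensor products follows from common right-multiples.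
    The quotient is thus presented by the colours of F and all skein relations
    which hold in it.  Since [t, s] maps [s p, k] to [t p, k], and every point
    of Q has the form [s p, k], the elements [t, s] and [t', s] of G act in the
    same way if and only if t and t' have the same image under beta.  So the
    kernel of alpha is the kernel of the map from G to the FS group of the
    quotient; applying the same criterion in the quotient gives faithfulness. *)

Set Implicit Arguments.
Unset Strict Implicit.
Unset Printing Implicit Defensive.

Local Open Scope quotient_scope.

(** * Tensor decompositions, first leaves and identity forests *)

Section Tensor.
Variable C : FScat.
Let th := FS_theory C.
Implicit Types f g p : C.

(** Follows from the uniqueness of the decomposition into trees: the number of roots tells where to
    cut the list. *)
Lemma tens_inj f g f' g' : root f = root f' -> tens f g = tens f' g' ->
  f = f' /\ g = g'.
Proof.
move=> rf /(congr1 (@trees C)); rewrite !trees_tens => /eqP.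
rewrite eqseq_cat ?size_trees // => /andP [/eqP e /eqP e'].
have [_ _ <-] := treesP f; have [_ _ <-] := treesP f'.
by have [_ _ <-] := treesP g; have [_ _ <-] := treesP g'; rewrite e e'.
Qed.

Lemma tens_split f m n : 0 < m -> 0 < n -> root f = m + n ->
  exists a b, [/\ f = tens a b, root a = m & root b = n].
Proof.
move=> m0 n0 rf; have [|a [b [ef ra]]] := @forest_split _ f m.
  by rewrite m0 rf -[X in X < _]addn0 ltn_add2l.
exists a, b; split=> //; apply/eqP; rewrite -(eqn_add2l m) -rf ef.
by rewrite (root_tens th) ra.
Qed.

Lemma first_leaf_tensl f g k : k <= root f ->
  first_leaf (tens f g) k = first_leaf f k.
Proof.
move=> kf; rewrite /first_leaf /forest_shape trees_tens map_cat takel_cat //.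
by rewrite size_map size_trees.
Qed.

Lemma first_leaf_tensr f g k :
  first_leaf (tens f g) (root f + k) = leaf f + first_leaf g k.
Proof.
rewrite /first_leaf /forest_shape trees_tens map_cat take_cat size_map size_trees.
by rewrite ltnNge leq_addr /= addKn sumn_cat sumn_shape.
Qed.

Lemma root_identity n : 0 < n -> root (ident C n) = n.
Proof.
move=> n0; have nn : nseq n (@one C) != [::] by rewrite -size_eq0 size_nseq -lt0n.
by rewrite /ident (root_tensl nn) map_nseq sumn_nseq (root_one th) mul1n.
Qed.

Lemma leaf_identity n : 0 < n -> leaf (ident C n) = n.
Proof.
move=> n0; have nn : nseq n (@one C) != [::] by rewrite -size_eq0 size_nseq -lt0n.
by rewrite /ident (leaf_tensl nn) map_nseq sumn_nseq (leaf_one th) mul1n.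
Qed.

End Tensor.

(** * Equivalence of pointed forests and of forests *)

Section ForestEqv.
Variable F : OreFScat.
Let th := FS_theory F.
Implicit Types (f g h p q : F) (x y z : F * nat).

(* The relation defining [Q], for pointed forests with any number of roots. *)
Definition pointed_eqv x y := exists p q,
  [/\ root p = leaf x.1, root q = leaf y.1,
      comp x.1 p = comp y.1 q & first_leaf p x.2 = first_leaf q y.2].

Lemma pointed_eqv_refl x : pointed_eqv x x.
Proof.
by exists (ident F (leaf x.1)), (ident F (leaf x.1)); rewrite root_identity // leaf_gt0.
Qed.

Lemma pointed_eqv_sym x y : pointed_eqv x y -> pointed_eqv y x.
Proof. by case=> p [q [? ? ? ?]]; exists q, p. Qed.

(** The two forests grown on [y] have a common right-multiple, and growing further preserves both
    equivalences. The bounds on the distinguished leaves allow [first_leaf_comp] to be applied. *)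
Lemma pointed_eqv_trans x y z : x.2 < leaf x.1 -> y.2 < leaf y.1 ->
  z.2 < leaf z.1 -> pointed_eqv x y -> pointed_eqv y z -> pointed_eqv x z.
Proof.
move=> jx jy jz [p [q [rp rq e1 e2]]] [p' [q' [rp' rq' e3 e4]]].
have [a [b [ra rb e]]] := Ore_common (etrans rq (esym rp')).
have lpq : leaf p = leaf q by rewrite -(leaf_comp th rp) e1 (leaf_comp th).
have lpq' : leaf p' = leaf q' by rewrite -(leaf_comp th rp') e3 (leaf_comp th).
exists (comp p a), (comp q' b).
split; rewrite ?(root_comp th) ?ra ?rb //.
  rewrite !(compA th) ?ra ?rb //.
  by rewrite e1 -e3 -!(compA th) ?ra ?rb // e.
rewrite !(@first_leaf_comp F) ?ra ?rb ?rp ?rq' //.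
by rewrite e2 -e4 -!(@first_leaf_comp F) ?ra ?rb ?rq ?rp' // e.
Qed.

Lemma pointed_eqv_comp f p k : root p = leaf f -> k < leaf f ->
  pointed_eqv (f, k) (comp f p, first_leaf p k).
Proof.
move=> rp kf; have lk : first_leaf p k < leaf p by rewrite first_leaf_lt ?rp.
exists p, (ident F (leaf p)); rewrite /= (leaf_comp th) // root_identity ?leaf_gt0 //.
split=> //; first by have := comp1 th (comp f p); rewrite (leaf_comp th).
by rewrite first_leaf_ident ?leaf_gt0 // ltnW.
Qed.

(** Left-cancellation removes [f] from the equation between forests; the equation between first
    leaves does not involve [f]. *)
Lemma pointed_eqv_cancel f g h k l : root g = leaf f -> root h = leaf f ->
  pointed_eqv (comp f g, k) (comp f h, l) -> pointed_eqv (g, k) (h, l).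
Proof.
move=> rg rh [p [q [/=]]]; rewrite !(leaf_comp th) // => rp rq.
rewrite -!(compA th) // => e1 e2; exists p, q; split=> //.
by apply: Ore_cancel e1; rewrite (root_comp th).
Qed.

Lemma pointed_eqv_compl f g h k l : root g = leaf f -> root h = leaf f ->
  pointed_eqv (g, k) (h, l) -> pointed_eqv (comp f g, k) (comp f h, l).
Proof.
move=> rg rh [p [q [/= rp rq e1 e2]]]; exists p, q; rewrite /= !(leaf_comp th) //.
by split=> //; rewrite -!(compA th) // e1.
Qed.

(** The factors without distinguished leaf need only have as many roots: a common right-multiple
    makes them equal. *)
Lemma pointed_eqv_tensl f g f' g' k k' : k < leaf f -> k' < leaf f' ->
  root g = root g' ->
  pointed_eqv (f, k) (f', k') -> pointed_eqv (tens f g, k) (tens f' g', k').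
Proof.
move=> kf kf' /Ore_common [c [d [rc rd ecd]]] [p [q [/= rp rq e1 e2]]].
exists (tens p c), (tens q d); rewrite /= !(root_tens th) !(leaf_tens th) rp rq rc rd.
by split=> //; rewrite ?(comp_tens th) ?e1 ?ecd // !first_leaf_tensl ?rp ?rq // ltnW.
Qed.

Lemma pointed_eqv_tensr f g f' g' k k' : root f = root f' ->
  pointed_eqv (g, k) (g', k') ->
  pointed_eqv (tens f g, leaf f + k) (tens f' g', leaf f' + k').
Proof.
move=> /Ore_common [c [d [rc rd ecd]]] [p [q [/= rp rq e1 e2]]].
exists (tens c p), (tens d q); rewrite /= !(root_tens th) !(leaf_tens th) rp rq rc rd.
split=> //; rewrite ?(comp_tens th) ?e1 ?ecd // -rc -rd !first_leaf_tensr e2.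
by rewrite -(leaf_comp th rc) ecd (leaf_comp th).
Qed.

(** The witnesses split along the leaves of the two factors, and [tens_inj] separates the equation
    between forests into one equation per factor. *)
Lemma pointed_eqv_untens f g f' g' i i' : root f = root f' ->
  pointed_eqv (tens f g, i) (tens f' g', i') ->
  (i < leaf f) = (i' < leaf f') /\
  if i < leaf f then pointed_eqv (f, i) (f', i')
  else pointed_eqv (g, i - leaf f) (g', i' - leaf f').
Proof.
move=> rf [p [q [/=]]]; rewrite !(leaf_tens th).
move=> /(tens_split (leaf_gt0 th f) (leaf_gt0 th g)) [a [b [-> ra rb]]].
move=> /(tens_split (leaf_gt0 th f') (leaf_gt0 th g')) [a' [b' [-> ra' rb']]].
rewrite !(comp_tens th) // => /tens_inj []; rewrite ?(root_comp th) // => ea eb.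
have la : leaf a = leaf a' by rewrite -(leaf_comp th ra) ea (leaf_comp th).
have side (c d : F) j :
    first_leaf (tens c d) j = if j < root c then first_leaf c j
                              else leaf c + first_leaf d (j - root c).
  case: ltnP => [/ltnW|] cj; first exact: first_leaf_tensl.
  by rewrite -first_leaf_tensr subnKC.
rewrite !side ra ra'.
(* Since [leaf a = leaf a'], a first leaf lying over [a] cannot equal one lying over [b'], nor the
   reverse, so the mixed cases are contradictory. *)
case: ltnP => h1; case: ltnP => h2 e.
- by split=> //; exists a, a'.
- have : first_leaf a i < leaf a by rewrite first_leaf_lt ?ra.
  by rewrite e la ltnNge leq_addr.
- have : first_leaf a' i' < leaf a' by rewrite first_leaf_lt ?ra'.
  by rewrite -e la ltnNge leq_addr.
- split=> //; exists b, b'; split=> //; move: e; rewrite la; exact: addnI.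
Qed.

(* Equality of [beta f] and [beta g], see [beta_forest_eqvP]. *)
Definition forest_eqv f g := [/\ root f = root g, leaf f = leaf g
  & forall p k, root p = leaf f -> k < leaf p ->
    pointed_eqv (comp f p, k) (comp g p, k)].

Lemma forest_eqv_refl f : forest_eqv f f.
Proof. by split=> // p k _ _; exact: pointed_eqv_refl. Qed.

Lemma forest_eqv_sym f g : forest_eqv f g -> forest_eqv g f.
Proof.
move=> [rfg lfg H]; split=> // p k rp kp; apply/pointed_eqv_sym/H => //.
by rewrite lfg.
Qed.

Lemma forest_eqv_trans f g h : forest_eqv f g -> forest_eqv g h -> forest_eqv f h.
Proof.
move=> [rfg lfg H] [rgh lgh H']; split; rewrite ?rfg ?lfg // => p k rp kp.
have rp' := etrans rp lgh; have rp'' := etrans rp (esym lfg).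
by apply: pointed_eqv_trans (H _ _ rp'' kp) (H' _ _ rp kp); rewrite (leaf_comp th).
Qed.

Lemma forest_eqv_pointed f g k : forest_eqv f g -> k < leaf f ->
  pointed_eqv (f, k) (g, k).
Proof.
move=> [_ lfg H] kf; have := H (ident F (leaf f)) k.
rewrite root_identity ?leaf_identity ?leaf_gt0 // (comp1 th) lfg (comp1 th).
by apply; rewrite -?lfg.
Qed.

(** Testing [comp f p] on [q] is testing [f] on [comp p q]; this is where the quantification over
    all test forests is used. *)
Lemma forest_eqv_compr f g p : root p = leaf f -> forest_eqv f g ->
  forest_eqv (comp f p) (comp g p).
Proof.
move=> rp [rfg lfg H]; have rp' := etrans rp lfg.
split; rewrite ?(root_comp th) ?(leaf_comp th) // => q k rq kq.
by rewrite -!(compA th) //; apply: H; rewrite ?(root_comp th) ?(leaf_comp th).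
Qed.

Lemma forest_eqv_compl f g h : root g = leaf f -> forest_eqv g h ->
  forest_eqv (comp f g) (comp f h).
Proof.
move=> rg [rgh lgh H]; have rh : root h = leaf f by rewrite -rgh.
split; rewrite ?(root_comp th) ?(leaf_comp th) // => p k rp kp.
have rp' := etrans rp lgh; rewrite -!(compA th) //.
by apply: pointed_eqv_compl; rewrite ?(root_comp th) //; exact: H.
Qed.

Lemma forest_eqv_comp f f' g g' : root g = leaf f ->
  forest_eqv f f' -> forest_eqv g g' -> forest_eqv (comp f g) (comp f' g').
Proof.
move=> rg ff gg; apply: forest_eqv_trans (forest_eqv_compr rg ff) _.
by apply: forest_eqv_compl => //; case: ff => _ <-.
Qed.

Lemma forest_eqv_cancel f g h : root g = leaf f -> root h = leaf f ->
  forest_eqv (comp f g) (comp f h) -> forest_eqv g h.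
Proof.
move=> rg rh [_]; rewrite !(leaf_comp th) // => lgh H; split=> //.
  by rewrite rg rh.
move=> p k rp kp; have rp' := etrans rp lgh; apply: (@pointed_eqv_cancel f).
- by rewrite (root_comp th).
- by rewrite (root_comp th).
- by rewrite !(compA th) //; apply: H.
Qed.

(** A test forest splits as [tens a b]. If the leaf lies over [a], the equivalence of [f] and [f']
    applies, and otherwise that of [g] and [g']; common right-multiples take care of the other
    factor. *)
Lemma forest_eqv_tens f f' g g' : forest_eqv f f' -> forest_eqv g g' ->
  forest_eqv (tens f g) (tens f' g').
Proof.
move=> [rf lf Hf] [rg lg Hg]; split.
- by rewrite !(root_tens th) rf rg.
- by rewrite !(leaf_tens th) lf lg.
move=> p k; rewrite (leaf_tens th).
move=> /(tens_split (leaf_gt0 th f) (leaf_gt0 th g)) [a [b [-> ra rb]]].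
have ra' := etrans ra lf; have rb' := etrans rb lg.
rewrite (leaf_tens th) !(comp_tens th) //; case: (ltnP k (leaf a)) => kl lk.
  apply: pointed_eqv_tensl; rewrite ?(root_comp th) ?(leaf_comp th) //; exact: Hf.
have := @pointed_eqv_tensr (comp f a) (comp g b) (comp f' a) (comp g' b)
  (k - leaf a) (k - leaf a).
rewrite !(root_comp th) ?(leaf_comp th) // subnKC //; apply=> //.
by apply: Hg; rewrite // -(ltn_add2l (leaf a)) subnKC.
Qed.

(* The tree to which a leaf belongs is an invariant of [pointed_eqv], hence
   equivalent forests have trees with the same numbers of leaves. *)
Lemma forest_eqv_untens f f' g g' : root f = root f' ->
  forest_eqv (tens f g) (tens f' g') -> forest_eqv f f' /\ forest_eqv g g'.
Proof.
move=> rf H; case: (H); rewrite !(root_tens th) !(leaf_tens th) rf => /addnI rg.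
move=> lfg H3; have same k : k < leaf f + leaf g -> (k < leaf f) = (k < leaf f').
  move=> lk; have := @forest_eqv_pointed _ _ k H; rewrite (leaf_tens th) lk.
  by move=> /(_ isT) /pointed_eqv_untens [].
have lf : leaf f = leaf f'.
  have := leaf_gt0 th g; have := leaf_gt0 th g' => h1 h2.
  case: (ltngtP (leaf f) (leaf f')) => // c.
    have := same (leaf f); rewrite ltnn c -[X in X < _]addn0 ltn_add2l h2.
    by move=> /(_ isT).
  have := same (leaf f'); rewrite ltnn c lfg -[X in X < _]addn0 ltn_add2l h1.
  by move=> /(_ isT).
have lg : leaf g = leaf g' by move: lfg; rewrite lf => /addnI.
(* To test one factor on [p], the other factor is composed with an identity forest. *)
split; split=> // p k rp kp.
  have rp' := etrans rp lf; have rg0 := root_identity F (leaf_gt0 th g).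
  have [||] // := H3 (tens p (ident F (leaf g))) k.
  + by rewrite (root_tens th) rp rg0.
  + by rewrite (leaf_tens th) ltn_addr.
  rewrite !(comp_tens th) ?rg0 // => p' [q' h].
  have [] := pointed_eqv_untens _ (ex_intro _ p' (ex_intro _ q' h));
    rewrite ?(root_comp th) ?(leaf_comp th) ?rg0 ?ltn_addr ?kp //.
have rp' := etrans rp lg; have rf0 := root_identity F (leaf_gt0 th f).
have lf0 := leaf_identity F (leaf_gt0 th f).
have [||] // := H3 (tens (ident F (leaf f)) p) (leaf f + k).
+ by rewrite (root_tens th) rp rf0.
+ by rewrite (leaf_tens th) lf0 ltn_add2l.
rewrite !(comp_tens th) ?rf0 -?lf // => p' [q' h].
have [] := pointed_eqv_untens _ (ex_intro _ p' (ex_intro _ q' h));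
  rewrite ?(root_comp th) ?(leaf_comp th) ?rf0 ?lf0 -?lf ?ltn_add2l ?kp //.
by rewrite ltnNge leq_addr addKn.
Qed.

(** Trees are split off one at a time; counting roots excludes lists of different lengths. This
    reduces the equivalence of forests to that of trees. *)
Lemma forest_eqv_tensl (s s' : seq F) :
  s != [::] -> s' != [::] -> all (@is_tree F) s -> all (@is_tree F) s' ->
  forest_eqv (tensl s) (tensl s') <-> List.Forall2 forest_eqv s s'.
Proof.
move=> n n' a a'; split.
  elim: s s' n n' a a' => // t s IH [//|t' s'] _ _ /= /andP [/eqP rt a] /andP [/eqP rt' a'].
  have pos (r : seq F) : r != [::] -> 0 < sumn (map root r).
    by case: r => //= u r _; rewrite addn_gt0 root_gt0.
  case: s IH a => [|u s] IH a; case: s' a' => [|u' s'] a'.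
  - by move=> H; constructor=> //; constructor.
  - case=> + _ _; rewrite (root_tens th) rt rt' => e.
    by have := root_gt0 th (tensl (u' :: s')); move: e; case: root.
  - case=> + _ _; rewrite (root_tens th) rt rt' => e.
    by have := root_gt0 th (tensl (u :: s)); move: e; case: root.
  move=> /(forest_eqv_untens (etrans rt (esym rt'))) [ht hs].
  by constructor=> //; apply: IH.
move=> H; elim: H n n' {a a'} => // t t' {}s {}s' tt ss IH _ _.
case: ss IH => [|u u' {}s {}s' uu ss] IH //.
by rewrite (@tensl_cons F t (u :: s)) // (@tensl_cons F t' (u' :: s')) //; apply: forest_eqv_tens => //; exact: IH.
Qed.

Lemma forest_eqv_trees f f' :
  forest_eqv f f' <-> List.Forall2 forest_eqv (trees f) (trees f').
Proof.
have [n a e] := treesP f; have [n' a' e'] := treesP f'.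
by rewrite -(forest_eqv_tensl n n' a a') e e'.
Qed.

End ForestEqv.

(** * Leaf indices and equality of maps with varying domain and codomain *)

Lemma reshape_index_cons a s l : reshape_index (a :: s) l =
  if l < a then 0 else (reshape_index s (l - a)).+1.
Proof.
rewrite /reshape_index /=; case: ltnP => la; first by have /eqP -> : l.+1 - a == 0.
by rewrite subSn.
Qed.

(** If the first blocks had different sizes, the position just after the shorter one would lie in
    block 0 for one list only. It serves to recover the shape of a forest from the assignment of its
    leaves to its trees. *)
Lemma reshape_index_inj (s s' : seq nat) : size s = size s' -> sumn s = sumn s' ->
  (forall l, l < sumn s -> reshape_index s l = reshape_index s' l) -> s = s'.
Proof.
elim: s s' => [|a s IH] [|a' s'] //= [] es ess H.
have ea : a = a'.
  case: (ltngtP a a') => // c.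
    have := H a; rewrite !reshape_index_cons ltnn c => /(_ _)/[!ess].
    by rewrite (leq_trans c) ?leq_addr // => /(_ isT).
  have := H a'; rewrite !reshape_index_cons ltnn c => /(_ _).
  by rewrite (leq_trans c) ?leq_addr // => /(_ isT).
move: ess H; rewrite ea => /addnI ess H; congr (_ :: _); apply: IH => // l ls.
have := H (a' + l); rewrite !reshape_index_cons ltn_add2l ls ltnNge leq_addr /= addKn.
by move=> /(_ isT) [].
Qed.

Lemma Forall2_nthP (A B : Type) (R : A -> B -> Prop) a b (s : seq A) (t : seq B) :
  List.Forall2 R s t <->
  size s = size t /\ forall i, i < size s -> R (nth a s i) (nth b t i).
Proof.
split.
  by elim=> // x y {}s {}t xy _ [es IH]; split=> [/=|[|i]] //; [rewrite es|exact: IH].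
elim: s t => [|x s IH] [|y t] //= [] // [es] H; constructor; first exact: (H 0).
by apply: IH; split=> // i; exact: (H i.+1).
Qed.

(** Families are taken on all of [nat] and indices are compared as numbers, so that equality of
    [beta] arrows can be used without transporting along equalities of dimensions. *)
Lemma existT_fun_eqP (A : Type) n m n' m'
    (f : ('I_n -> A) -> 'I_m -> A) (f' : ('I_n' -> A) -> 'I_m' -> A) :
  inhabited A ->
  let P d := ('I_d.1 -> A) -> 'I_d.2 -> A in
  existT P (n, m) f = existT P (n', m') f' <->
  [/\ n = n', m = m' & forall (q : nat -> A) (l : 'I_m) (l' : 'I_m'),
    l = l' :> nat -> f (fun i => q i) l = f' (fun i => q i) l'].
Proof.
move=> [a0] P; split=> [e|[en em]].
  (* Evaluation at a family on [nat] and a plain number makes sense for every dependent pair, so it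
     can be applied to both sides of [e]. *)
  pose ev (d : {d & P d}) (q : nat -> A) (l : nat) : option A :=
    omap (projT2 d (fun i => q i)) (insub l).
  have [en em] : (n, m) = (n', m') := congr1 (@projT1 _ _) e.
  split=> // q l l' ll; have := congr1 (fun d => ev d q l) e.
  by rewrite /ev /= {2}ll !valK => -[].
case: n' / en f' => f'; case: m' / em f' => f' H; congr existT.
apply/funext => q; apply/funext => l.
(* Extension of [q] to all of [nat], with the value [a0] out of range. *)
pose q' i := if insub i is Some j then q j else a0.
have -> : q = (fun i : 'I_n => q' i) by apply/funext => i; rewrite /q' valK.
exact: H.
Qed.

(** * Growing the trees of a forest separately *)

Section TreesOf.
Variable C : FScat.
Let th := FS_theory C.
Implicit Types (f g p t u : C) (s : seq C).

Lemma first_leafK f j : j < root f -> reshape_index (forest_shape f) (first_leaf f j) = j.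
Proof.
move=> jf; rewrite -[first_leaf f j]addn0; apply: flatten_indexKl.
by rewrite (nth_map one) ?size_trees // leaf_gt0.
Qed.

Lemma comp_one_tree t : root t = 1 -> comp one t = t.
Proof. by move=> rt; have := comp1l th t; rewrite rt. Qed.

(** A forest can be grown in two stages: first the tree [u], then all the others. *)
Lemma comp_tensl_ones s1 u s2 : all (@is_tree C) s1 -> all (@is_tree C) s2 ->
  comp (tensl (nseq (size s1) one ++ u :: nseq (size s2) one))
       (tensl (s1 ++ nseq (leaf u) one ++ s2)) = tensl (s1 ++ u :: s2).
Proof.
move=> a1 a2; elim: s1 a1 => [_|t s1 IH].
  rewrite !cat0s; have n0 : nseq (leaf u) (@one C) != [::].
    by rewrite -size_eq0 size_nseq -lt0n leaf_gt0.
  have [->|n2] := eqVneq s2 [::]; first by rewrite cats0; exact: (comp1 th).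
  have n2' : nseq (size s2) (@one C) != [::].
    by rewrite -size_eq0 size_nseq size_eq0.
  rewrite tensl_cat // !(@tensl_cons C) // (comp_tens th) ?root_identity ?leaf_gt0 //.
    rewrite (comp1 th); congr tens; rewrite -(sumn_root_trees a2) -root_tensl //.
    exact: (comp1l th).
  rewrite root_tensl // sumn_root_trees // leaf_tensl // map_nseq sumn_nseq.
  by rewrite (leaf_one th) mul1n.
rewrite [all _ _]/= => /andP [/eqP rt a1].
have nA (a : C) r : nseq (size s1) one ++ a :: r != [::] by case: (size s1).
have nB r : s1 ++ nseq (leaf u) one ++ r != [::].
  have := leaf_gt0 th u; case: (s1) => //=; case: (leaf u) => //.
have nC r : s1 ++ u :: r != [::] by case: (s1).
rewrite [nseq (size (t :: s1)) one]/= !cat_cons !(@tensl_cons C) //.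
rewrite (comp_tens th); first by rewrite IH // comp_one_tree.
  by rewrite rt (leaf_one th).
rewrite root_tensl // leaf_tensl // !map_cat /= !sumn_cat /= !map_nseq !sumn_nseq.
by rewrite !(root_one th) !(leaf_one th) !mul1n !sumn_root_trees.
Qed.

(** A colour exists, and an interior vertex of that colour with two leaves below it is such a
    tree. *)
Lemma exists_caret : exists t : C, root t = 1 /\ leaf t = 2.
Proof.
case: C => D [S [R [[c] hR [phi hphi]]]] /=.
exists (phi (\pi_(equot (skein_cong_equiv R)) (tree_forest (Node c Leaf Leaf)))).
by rewrite (root_psi hR hphi) (leaf_psi hR hphi).
Qed.

End TreesOf.

(** * The kernel of beta *)

Section BetaForestEqv.
Variable F : OreFScat.
Let th := FS_theory F.
Implicit Types (f g p t u : F) (x y : ptree F).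

Lemma pclass_eqv x y : pclass x = pclass y <-> pointed_eqv (val x) (val y).
Proof. exact: pclass_eq. Qed.

(** The forest composed with [t] when gluing [y] depends on [t] only through its number of leaves,
    so one [p] serves for every [t']. *)
Lemma plug_valE x t j y : val x = (t, j) -> exists p, [/\ root p = leaf t,
  j + (val y).2 < leaf p & forall x' t', val x' = (t', j) -> leaf t' = leaf t ->
     val (plug x' y) = (comp t' p, j + (val y).2)].
Proof.
move=> ex; case ey : (val y) => [s k].
have [rt jt] : root t = 1 /\ j < leaf t by have := ptreeP x; rewrite ex.
have [rs ks] : root s = 1 /\ k < leaf s by have := ptreeP y; rewrite ey.
have n0 : nseq j one ++ s :: nseq (leaf t - j.+1) one != [::] by case: (j).
exists (tensl (nseq j one ++ s :: nseq (leaf t - j.+1) one)); split.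
- rewrite root_tensl // map_cat sumn_cat /= !map_nseq !sumn_nseq (root_one th).
  by rewrite !mul1n rs add1n -addSnnS subnKC.
- rewrite leaf_tensl // map_cat sumn_cat /= !map_nseq !sumn_nseq (leaf_one th).
  by rewrite !mul1n ltn_add2l ltn_addr.
- by move=> x' t' ex' lt; rewrite [LHS]/(plug_val x' y) /plug_val ex' ey lt.
Qed.

(** Here [u] is the tree of [p] containing [k]; [r] grows only [u], and [q] grows the other trees
    while staying trivial above the leaves of [u]. An arbitrary test forest is thus reduced to a
    forest of the kind used by [plug]. *)
Lemma forest_at p k : k < leaf p -> exists u j i q,
  [/\ root u = 1, i < leaf u, j < root p & k = first_leaf q (j + i)] /\
  let r := tensl (nseq j one ++ u :: nseq (root p - j.+1) one) in
  [/\ root r = root p, root q = leaf r, j + i < root q & comp r q = p].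
Proof.
move=> kp; pose j := reshape_index (forest_shape p) k.
pose i := reshape_offset (forest_shape p) k.
have ks : k < sumn (forest_shape p) by rewrite sumn_shape.
have jp : j < root p by rewrite -size_shape reshape_indexP.
have js : j < size (trees p) by rewrite size_trees.
have := reshape_offsetP ks; rewrite (nth_map one) //; set u := nth _ _ _ => iu.
have [np ap ep] := treesP p.
have ets : trees p = take j (trees p) ++ u :: drop j.+1 (trees p).
  by rewrite -drop_nth // cat_take_drop.
have st : size (take j (trees p)) = j by rewrite size_takel // ltnW.
have sd : size (drop j.+1 (trees p)) = root p - j.+1 by rewrite size_drop size_trees.
have /and3P [at_ /eqP ru ad] : [&& all (@is_tree F) (take j (trees p)), root u == 1
    & all (@is_tree F) (drop j.+1 (trees p))] by move: ap; rewrite {1}ets all_cat.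
move: ets at_ ad st sd; move: (take _ _) (drop _ _) => s1 s2 ets a1 a2 s1j s2j.
have nr : nseq j one ++ u :: nseq (root p - j.+1) one != [::] by case: (j).
have nq : s1 ++ nseq (leaf u) one ++ s2 != [::].
  by have := leaf_gt0 th u; case: (s1); case: (leaf u).
have lr : leaf (tensl (nseq j one ++ u :: nseq (root p - j.+1) one))
    = j + (leaf u + (root p - j.+1)).
  rewrite leaf_tensl // map_cat sumn_cat /= !map_nseq !sumn_nseq.
  by rewrite (leaf_one th) !mul1n.
have aq : all (@is_tree F) (s1 ++ nseq (leaf u) one ++ s2).
  by rewrite !all_cat a1 a2 all_nseq /is_tree (root_one th) !orbT.
have rq : root (tensl (s1 ++ nseq (leaf u) one ++ s2)) = j + (leaf u + (root p - j.+1)).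
  rewrite root_tensl // sumn_root_trees // !size_cat size_nseq s1j s2j //.
exists u, j, i, (tensl (s1 ++ nseq (leaf u) one ++ s2)); split; split=> //.
- rewrite -(reshape_indexK (forest_shape p) k) /flatten_index -/j -/i.
  rewrite {1}/forest_shape ets /first_leaf /forest_shape trees_tensl // !map_cat.
  rewrite take_size_cat ?size_map // take_cat size_map s1j ltnNge leq_addr /=.
  rewrite addKn takel_cat ?size_map ?size_nseq 1?ltnW //.
  by rewrite sumn_cat map_nseq take_nseq 1?ltnW // sumn_nseq (leaf_one th) mul1n.
- rewrite root_tensl // map_cat sumn_cat /= !map_nseq !sumn_nseq (root_one th).
  by rewrite ru !mul1n add1n -addSnnS subnKC.
- by rewrite rq lr.
- by rewrite rq ltn_add2l ltn_addr.
- by rewrite -{1}s1j -s2j comp_tensl_ones // -ets ep.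
Qed.

(** In one direction, gluing is composition with a particular test forest. In the other, [forest_at]
    moves the leaf of a test forest [p] back to a leaf of such a particular forest. *)
Lemma tree_eqvP t t' : root t = 1 -> root t' = 1 -> leaf t = leaf t' ->
  forest_eqv t t' <-> forall x x', (val x).1 = t -> (val x').1 = t' ->
    (val x).2 = (val x').2 -> beta_pt x = beta_pt x'.
Proof.
move=> rt rt' lt; split=> [[_ _ H] x x' ex ex' e2|H].
  apply/funext => u; have [y ->] := pclass_surj u; rewrite !beta_ptE.
  have vx : val x = (t, (val x).2) by rewrite -ex; case: (val x).
  have vx' : val x' = (t', (val x).2) by rewrite -ex' e2; case: (val x').
  have [p [rp kp E]] := plug_valE y vx.
  by apply/pclass_eqv; rewrite (E _ _ vx) // (E _ _ vx') //; exact: H.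
split=> [|//|p k rp kp]; first by rewrite rt rt'.
have [u [j [i [q [[ru iu jp ek] [rr rq jiq e]]]]]] := forest_at kp.
move: rr rq jiq e; rewrite {}ek in kp *; set r := tensl _ => rr rq jiq e.
have jt : j < leaf t by rewrite -rp.
have jt' : j < leaf t' by rewrite -lt.
have [x ex] := ptree_exists rt jt; have [x' ex'] := ptree_exists rt' jt'.
have [y ey] := ptree_exists ru iu.
have := H x x'; rewrite ex ex' => /(_ erefl erefl erefl) /(congr1 (@^~ (pclass y))).
rewrite !beta_ptE => /pclass_eqv.
rewrite [val (plug x y)]/(plug_val x y) [val (plug x' y)]/(plug_val x' y).
rewrite /plug_val ex ex' ey -lt -rp -/r => Hr.
have rt1 : root r = leaf t by rewrite rr rp.
have rt2 : root r = leaf t' by rewrite rt1 lt.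
have step (v : F) : root r = leaf v ->
    pointed_eqv (comp v r, j + i) (comp v p, first_leaf q (j + i)).
  move=> rv; rewrite -[in X in pointed_eqv _ X]e (compA th) //.
  by apply: pointed_eqv_comp; rewrite (leaf_comp th) // -rq.
have rp' : root p = leaf t' by rewrite rp.
apply: (@pointed_eqv_trans _ _ (comp t' r, j + i));
  rewrite /= ?(leaf_comp th) -?rq //; last exact: step.
apply: (@pointed_eqv_trans _ _ (comp t r, j + i));
  rewrite /= ?(leaf_comp th) -?rq //; exact/pointed_eqv_sym/step.
Qed.

Lemma betaE f (q : 'I_(root f) -> pspace F) l :
  beta q l = beta_pt (leaf_ptree l) (q (leaf_root l)).
Proof. by []. Qed.

(** Left-cancellation forces the two witnesses to coincide, and first leaves of different trees of
    one forest differ. *)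
Lemma pointed_eqv_inj f i j : i < leaf f -> j < leaf f ->
  pointed_eqv (f, i) (f, j) -> i = j.
Proof.
move=> li lj [p [q [/= rp rq e1]]]; have -> := Ore_cancel rp rq e1.
by move=> /(congr1 (reshape_index (forest_shape q))); rewrite !first_leafK ?rq.
Qed.

(** The points are the two leaves of a tree with two leaves: glued at one place, they remain
    distinct leaves of one tree. That the same pair works for all [x] lets it detect on which
    coordinate a component of [beta] depends. *)
Lemma beta_pt_nonconstant : exists u v : pspace F, forall x, beta_pt x u <> beta_pt x v.
Proof.
have [t [rt lt]] := exists_caret F.
have [|y ey] := @ptree_exists F t 0 rt; first by rewrite lt.
have [|z ez] := @ptree_exists F t 1 rt; first by rewrite lt.
exists (pclass y), (pclass z) => x.
rewrite !beta_ptE => /pclass_eqv.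
rewrite [val (plug x y)]/(plug_val x y) [val (plug x z)]/(plug_val x z).
rewrite /plug_val ey ez; case ex : (val x) => [s j].
have [rs js] : root s = 1 /\ j < leaf s by have := ptreeP x; rewrite ex.
move=> /pointed_eqv_inj.
have n0 : nseq j one ++ t :: nseq (leaf s - j.+1) one != [::] by case: (j).
have rr : root (tensl (nseq j one ++ t :: nseq (leaf s - j.+1) one)) = leaf s.
  rewrite root_tensl // map_cat sumn_cat /= !map_nseq !sumn_nseq (root_one th).
  by rewrite !mul1n rt add1n -addSnnS subnKC.
rewrite (leaf_comp th) // leaf_tensl // map_cat sumn_cat /= !map_nseq !sumn_nseq.
rewrite (leaf_one th) !mul1n lt !ltn_add2l !ltn_addr // => /(_ isT isT).
by move=> /addnI.
Qed.

(** Both sides are compared tree by tree: equality of [beta] determines the shape, after which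
    [tree_eqvP] applies to each pair of trees. *)
Lemma beta_forest_eqvP f f' : beta_eqv f f' <-> forest_eqv f f'.
Proof.
have ne : inhabited (pspace F) by case: beta_pt_nonconstant => u _.
have tr g i : i < root g -> root (nth one (trees g) i) = 1.
  have [_ a _] := treesP g => ig; apply/eqP/(allP a).
  by rewrite mem_nth // size_trees.
have sz g : size (trees g) = root g := size_trees g.
have sh g i : i < root g -> nth 0 (forest_shape g) i = leaf (nth one (trees g) i).
  by move=> ig; rewrite (nth_map one) ?sz.
have vl g (l : 'I_(leaf g)) : val (leaf_ptree l) =
  (nth one (trees g) (reshape_index (forest_shape g) l), reshape_offset (forest_shape g) l) by [].
rewrite forest_eqv_trees (Forall2_nthP _ one one) !sz.
split.
  move=> /existT_fun_eqP => /(_ ne) [rf lf H].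
  (* If a leaf belonged to trees of different indices in [f] and [f'], changing the coordinate of
     the tree of [f] from [u] to [v] would change the component of [beta f] but not that of
     [beta f']. *)
  have esh : forest_shape f = forest_shape f'.
    apply: reshape_index_inj; rewrite ?size_shape ?sumn_shape // => l ll.
    apply: contrapT => ne'; have [u [v uv]] := beta_pt_nonconstant.
    have ll' : l < leaf f' by rewrite -lf.
    have := H (fun=> u) (Ordinal ll) (Ordinal ll') erefl.
    have := H (fun i => if i == reshape_index (forest_shape f) l then v else u)
      (Ordinal ll) (Ordinal ll') erefl.
    rewrite !betaE /= eqxx; case: eqP => [/esym //|_] <-; exact: uv.
  split=> // i ir; have ir' : i < root f' by rewrite -rf.
  apply/tree_eqvP; rewrite ?tr // -?sh // ?esh // => x x' ex ex' e2.
  have lx : (val x).2 < nth 0 (forest_shape f) i.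
    by rewrite sh // -ex; have [] := ptreeP x.
  have := flatten_indexP lx; rewrite sumn_shape => ll.
  have ll' : flatten_index (forest_shape f) i (val x).2 < leaf f' by rewrite -lf.
  apply/funext => u; have := H (fun=> u) (Ordinal ll) (Ordinal ll') erefl.
  rewrite !betaE; congr (_ = _); congr (beta_pt _ _); apply: val_inj.
    rewrite vl [nat_of_ord (Ordinal _)]/= flatten_indexKl // flatten_indexKr // -ex.
    by rewrite -surjective_pairing.
  rewrite vl [nat_of_ord (Ordinal _)]/= -esh flatten_indexKl // flatten_indexKr //.
  by rewrite -ex' e2 -surjective_pairing.
move=> [rf H]; have esh : forest_shape f = forest_shape f'.
  apply: (@eq_from_nth _ 0); first by rewrite !size_shape.
  move=> i; rewrite size_shape => ir; rewrite !sh -?rf //.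
  by case: (H i ir).
have lf : leaf f = leaf f' by rewrite -!sumn_shape esh.
apply/existT_fun_eqP => //; split=> // q l l' ll.
have := ltn_ord l; rewrite -{2}sumn_shape => ls; have := reshape_indexP ls.
rewrite size_shape => lr; rewrite !betaE /= -ll -esh; congr (_ _).
have := H _ lr; have lr' := lr; rewrite rf in lr'.
have [e1 e2 _] := H _ lr.
move=> /tree_eqvP; rewrite !tr // => /(_ erefl erefl e2); apply=> //.
by rewrite !vl -ll esh.
by rewrite !vl -ll esh.
Qed.

End BetaForestEqv.

(** * The quotient by the kernel of beta is an Ore FS category *)

Section Quotient.
Variable F : OreFScat.
Let th := FS_theory F.
Implicit Types f g p : F.

Lemma fclass_eqP f g : fclass f = fclass g <-> forest_eqv f g.
Proof. by rewrite fclass_eq beta_forest_eqvP. Qed.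

Lemma root_fclass f : root (fclass f) = root f.
Proof. by case: (fclass_dom f). Qed.

Lemma leaf_fclass f : leaf (fclass f) = leaf f.
Proof. by case: (fclass_dom f). Qed.

Lemma fclass_repr (a : FS_quot F) : fclass (repr a) = a.
Proof. exact: reprK. Qed.

Lemma repr_fclass f : forest_eqv (repr (fclass f)) f.
Proof. by apply/fclass_eqP; exact: fclass_repr. Qed.

Lemma comp_fclass f g : root g = leaf f ->
  comp (fclass f) (fclass g) = fclass (comp f g).
Proof.
move=> rg; apply/fclass_eqP/forest_eqv_comp; try exact: repr_fclass.
by have [-> _ _] := repr_fclass g; have [_ -> _] := repr_fclass f.
Qed.

Lemma tens_fclass f g : tens (fclass f) (fclass g) = fclass (tens f g).
Proof. by apply/fclass_eqP/forest_eqv_tens; exact: repr_fclass. Qed.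

Lemma tensl_fclass (s : seq F) : s != [::] ->
  tensl (map (@fclass F) s) = fclass (tensl s).
Proof.
elim: s => // t [|u s] IH // _.
by rewrite (@tensl_cons F t (u :: s)) // -tens_fclass -IH.
Qed.

Lemma fclass_surj (a : FS_quot F) : exists f, a = fclass f.
Proof. by exists (repr a); rewrite fclass_repr. Qed.

(** The colours of [F] are kept, and [R'] relates all trees with equally many leaves whose images in
    [F] are equivalent. *)
Lemma FS_quot_presented : is_FS (FS_quot F).
Proof.
have [S [R [inhS hR [phi hphi]]]] := FScatP F.
pose psi (T : cforest S) : F := phi (\pi_(equot (skein_cong_equiv R)) T).
pose R' u v := nleaves u = nleaves v /\
  forest_eqv (psi (tree_forest u)) (psi (tree_forest v)).
have hR' : skein R' by move=> u v [].
have root_psi T : root (psi T) = size (val T) by exact: root_psi.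
have leaf_psi T : leaf (psi T) = fleaves (val T) by exact: leaf_psi.
have comp_psi T U : size (val U) = fleaves (val T) ->
  comp (psi T) (psi U) = psi (fcomp T U) by exact: comp_psi.
have tens_psi T U : tens (psi T) (psi U) = psi (ftens T U) by exact: tens_psi.
have psi_surj f : exists T, f = psi T by exact: psi_surj.
have trees_psi (T : cforest S) : trees (psi T) = [seq psi (tree_forest t) | t <- val T].
  apply: treesE; split.
  - by case: T => -[].
  - by apply/allP => _ /mapP [t _ ->]; rewrite /is_tree root_psi.
  - by rewrite (tensl_psi hphi (f := val T) (valP T)); congr psi; exact: val_inj.
(* The congruence generated by [R'] is no larger because [forest_eqv] is itself a congruence, and no
   smaller because equivalent forests have equivalent trees, each pair of which is a relation of
   [R']. *)
have cong T U : skein_cong R' T U <-> forest_eqv (psi T) (psi U).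
  split=> [|H].
    elim=> {T U} [u v []|T|T U _|U T V _ + _|T T' U U' e e' _ H _ H'|T T' U U' _ H _ H'] //.
    - exact: forest_eqv_refl.
    - exact: forest_eqv_sym.
    - exact: forest_eqv_trans.
    - rewrite -!comp_psi //; apply: forest_eqv_comp => //.
      by rewrite root_psi leaf_psi.
    - by rewrite -!tens_psi; apply: forest_eqv_tens.
  apply: Forall2_skein_cong => //; move/forest_eqv_trees: H; rewrite !trees_psi.
  elim: (val T) (val U) => [|t s IH] [|u s'] /= H; try by inversion H.
  case/List.Forall2_cons_iff: H => tu H; constructor; last exact: IH.
  apply: SkeinBase; split=> //; case: tu => _.
  by rewrite !leaf_psi /fleaves /= !addn0.
have eqQ (T U : cforest S) :
    \pi_(equot (skein_cong_equiv R')) T = \pi_(equot (skein_cong_equiv R')) U <->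
    fclass (psi T) = fclass (psi U).
  by rewrite fclass_eqP -cong; exact: equotP.
exists S, R'; split=> //.
exists (fun x => fclass (psi (repr x))).
have rep T : fclass (psi (repr (\pi_(equot (skein_cong_equiv R')) T))) = fclass (psi T).
  by apply/eqQ; rewrite reprK.
split.
- have [k phiK kK] : bijective phi by case: hphi.
  have psiK f : psi (repr (k f)) = f by rewrite /psi reprK kK.
  exists (fun a => \pi_(equot (skein_cong_equiv R')) (repr (k (repr a)))) => x.
    rewrite -[RHS]reprK; apply/eqQ; rewrite psiK; exact: fclass_repr.
  by rewrite rep psiK fclass_repr.
- by move=> x; rewrite root_fclass leaf_fclass root_psi leaf_psi.
- move=> x y h; rewrite rep comp_fclass ?comp_psi //.
  by rewrite root_psi leaf_psi.
- by move=> x y; rewrite rep tens_fclass tens_psi.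
- by rewrite rep; congr fclass; symmetry; exact: one_psi.
Qed.

Lemma FS_quot_Ore : is_Ore (FS_quot F).
Proof.
split.
- move=> a b c; have [f ->] := fclass_surj a; have [g ->] := fclass_surj b.
  have [h ->] := fclass_surj c; rewrite !root_fclass leaf_fclass => rg rh; rewrite !comp_fclass //.
  by move=> /fclass_eqP /forest_eqv_cancel H; apply/fclass_eqP/H.
- move=> a b; have [f ->] := fclass_surj a; have [g ->] := fclass_surj b.
  rewrite !root_fclass => /Ore_common [p [q [rp rq e]]].
  exists (fclass p), (fclass q); rewrite !root_fclass !leaf_fclass.
  by rewrite !comp_fclass // e.
Qed.

End Quotient.

(** * Comparing the actions of fractions with equal denominators *)

Section AlphaForestEqv.
Variable F : OreFScat.
Let th := FS_theory F.
Implicit Types (x y : tree_pair F).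

Lemma alpha_frac_eq x y : (val x).2 = (val y).2 ->
  alpha (frac x) = alpha (frac y) <-> forest_eqv (val x).1 (val y).1.
Proof.
have [tx sx lx] := tree_pairP x; have [ty sy ly] := tree_pairP y => exy.
have pt t p k : root t = 1 -> root p = leaf t -> k < leaf p ->
    exists z : ptree F, val z = (comp t p, k).
  by move=> rt rp kp; apply: ptree_exists; rewrite ?(root_comp th) ?(leaf_comp th).
have act w p k (z u : ptree F) : root p = leaf (val w).1 -> k < leaf p ->
    val z = (comp (val w).2 p, k) -> val u = (comp (val w).1 p, k) ->
    alpha (frac w) (pclass z) = pclass u.
  have [tw sw lw] := tree_pairP w => rp kp ez eu.
  have [v ev] : exists v : tree_pair F, val v = (comp (val w).1 p, comp (val w).2 p).
    by apply: tree_pair_exists; rewrite ?(root_comp th) ?(leaf_comp th) // -lw.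
  by rewrite -(frac_comp rp ev); apply: alphaE; rewrite ev ?ez ?eu.
have lxy : leaf (val x).1 = leaf (val y).1 by rewrite lx ly exy.
split=> [H|H].
  split=> [|//|p k rp kp]; first by rewrite tx ty.
  have rpx : root p = leaf (val x).2 by rewrite -lx.
  have rpy : root p = leaf (val y).1 by rewrite -lxy.
  have [[z ez] [u eu]] := (pt _ _ _ sx rpx kp, pt _ _ _ tx rp kp).
  have [v ev] := pt _ _ _ ty rpy kp.
  have := congr1 (@^~ (pclass z)) H; rewrite /= (act _ _ _ _ _ rp kp ez eu).
  by rewrite exy in ez; rewrite (act _ _ _ _ _ rpy kp ez ev) => /pclass_eqv; rewrite eu ev.
apply/funext => q; have [y0 ->] := pclass_surj q.
have [t0 j0] := ptreeP y0.
(* A common right-multiple of the shared denominator and of the tree of [y0] writes the point as the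
   class of a leaf of [comp (val x).2 p], on which [act] computes both actions. *)
have [p [p' [rpx rp' e]]] := Ore_common (etrans sx (esym t0)).
have kp : first_leaf p' (val y0).2 < leaf p.
  by rewrite -(leaf_comp th rpx) e (leaf_comp th) // first_leaf_lt ?rp'.
have rp : root p = leaf (val x).1 by rewrite lx.
have rpy : root p = leaf (val y).1 by rewrite -lxy.
have [[z ez] [u eu]] := (pt _ _ _ sx rpx kp, pt _ _ _ tx rp kp).
have [v ev] := pt _ _ _ ty rpy kp.
have <- : pclass z = pclass y0 by apply: pclass_comp rp' _; rewrite ez e.
rewrite (act _ _ _ _ _ rp kp ez eu); rewrite exy in ez.
rewrite (act _ _ _ _ _ rpy kp ez ev); apply/pclass_eqv; rewrite eu ev.
by case: H => _ _; apply.
Qed.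

End AlphaForestEqv.

(** * The FS group of the quotient, and faithfulness *)

Section QuotientGroup.
Variable F : OreFScat.
Let th := FS_theory F.
Let F' : OreFScat := @MkOreFScat (MkFScat (FS_quot_presented F)) (FS_quot_Ore F).
Implicit Types (f g p q : F) (x y : tree_pair F).

Lemma trees_fclass f : trees (fclass f) = map (@fclass F) (trees f).
Proof.
have [n a e] := treesP f; apply: (@treesE F'); split.
- by move: n; case: (trees f).
- apply/allP => _ /mapP [t /(allP a) ht ->]; move: ht.
  by rewrite /is_tree -(root_fclass t).
- by rewrite tensl_fclass // e.
Qed.

Lemma first_leaf_fclass f j : first_leaf (fclass f) j = first_leaf f j.
Proof.
rewrite /first_leaf /forest_shape trees_fclass -map_comp.
by congr (sumn (take _ _)); apply: eq_map => t; exact: leaf_fclass.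
Qed.

(** Witnesses in the quotient lift to [p] and [q] with [comp f p] and [comp g q] equivalent, hence
    equivalent at their common leaf; growing a pointed forest links these back to [f] and [g]. *)
Lemma pointed_eqv_fclass f g k l : k < leaf f -> l < leaf g ->
  @pointed_eqv F' (fclass f, k) (fclass g, l) -> pointed_eqv (f, k) (g, l).
Proof.
move=> kf lg [a [b []]]; have [p ->] := fclass_surj a; have [q ->] := fclass_surj b.
move=> rp' rq' H' e'.
have rp : root p = leaf f by rewrite -root_fclass -leaf_fclass; exact: rp'.
have rq : root q = leaf g by rewrite -root_fclass -leaf_fclass; exact: rq'.
have H : forest_eqv (comp f p) (comp g q).
  by apply/fclass_eqP; rewrite -!comp_fclass //; exact: H'.
have e : first_leaf p k = first_leaf q l by rewrite -!first_leaf_fclass; exact: e'.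
have kp : first_leaf p k < leaf p by rewrite first_leaf_lt ?rp.
have lq : first_leaf q l < leaf q by rewrite first_leaf_lt ?rq.
have lpq : leaf p = leaf q by case: H; rewrite !(leaf_comp th).
apply: (@pointed_eqv_trans _ _ (comp f p, first_leaf p k));
  rewrite /= ?(leaf_comp th) //; first exact: pointed_eqv_comp.
apply: (@pointed_eqv_trans _ _ (comp g q, first_leaf p k));
  rewrite /= ?(leaf_comp th) -?lpq //; last first.
  by rewrite e; apply/pointed_eqv_sym/pointed_eqv_comp.
by apply: forest_eqv_pointed; rewrite ?(leaf_comp th).
Qed.

(** Passing to the quotient a second time identifies nothing more; faithfulness rests on this. *)
Lemma forest_eqv_fclass f g : @forest_eqv F' (fclass f) (fclass g) -> forest_eqv f g.
Proof.
case=> rfg lfg H; split=> [||p k rp kp].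
- by rewrite -root_fclass -(root_fclass g).
- by rewrite -leaf_fclass -(leaf_fclass g).
have rp' : root p = leaf g by rewrite rp -leaf_fclass -(leaf_fclass g).
apply: pointed_eqv_fclass; rewrite ?(leaf_comp th) // -!comp_fclass //.
apply: H; last by move: kp; rewrite -leaf_fclass.
by rewrite -root_fclass -leaf_fclass in rp.
Qed.

Lemma val_pair_class x : val (pair_class x) = (fclass (val x).1, fclass (val x).2).
Proof. by []. Qed.

Lemma pair_class_eq x y : forest_eqv (val x).1 (val y).1 ->
  forest_eqv (val x).2 (val y).2 -> pair_class x = pair_class y.
Proof.
move=> /fclass_eqP e1 /fclass_eqP e2; apply: val_inj.
by rewrite !val_pair_class e1 e2.
Qed.

Lemma pair_class_surj (X : tree_pair F') : exists x, X = pair_class x.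
Proof.
have [r1 r2 l] := tree_pairP X.
have [x ex] := @tree_pair_exists F (repr (val X).1) (repr (val X).2) r1 r2 l.
exists x; apply: val_inj; apply: etrans (esym (val_pair_class x)).
by rewrite ex !fclass_repr -surjective_pairing.
Qed.

Lemma frac_pair_class_comp x y p : root p = leaf (val x).1 ->
  val y = (comp (val x).1 p, comp (val x).2 p) ->
  frac (F := F') (pair_class y) = frac (F := F') (pair_class x).
Proof.
move=> rp e; have [_ _ l] := tree_pairP x; apply: (@frac_comp F' _ _ (fclass p)).
  by rewrite [LHS]root_fclass [RHS]leaf_fclass.
apply: etrans (val_pair_class y) _; by rewrite e -!comp_fclass // -?l.
Qed.

(** It identifies the kernel of alpha with the kernel of the map to the FS group of the quotient,
    giving both the well-definedness and the injectivity of [quot_iso]. *)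
Lemma frac_pair_class_eqP x y :
  frac (F := F') (pair_class x) = frac (F := F') (pair_class y) <->
  alpha (frac x) = alpha (frac y).
Proof.
have [tx sx lx] := tree_pairP x; have [ty sy ly] := tree_pairP y.
(* Reduction to equal denominators, as [alpha_frac_eq] requires. *)
have [p [q [rp rq e]]] := Ore_common (etrans sx (esym sy)).
have [x' ex'] : exists z : tree_pair F, val z = (comp (val x).1 p, comp (val x).2 p).
  by apply: tree_pair_exists; rewrite ?(root_comp th) ?(leaf_comp th) ?lx.
have [y' ey'] : exists z : tree_pair F, val z = (comp (val y).1 q, comp (val y).2 q).
  by apply: tree_pair_exists; rewrite ?(root_comp th) ?(leaf_comp th) ?ly.
rewrite -lx in rp; rewrite -ly in rq.
rewrite -(frac_comp rp ex') -(frac_comp rq ey').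
rewrite -(frac_pair_class_comp rp ex') -(frac_pair_class_comp rq ey').
have {rp rq e ex' ey' tx sx lx ty sy ly p q} : (val x').2 = (val y').2.
  by rewrite ex' ey'.
move: x' y' => {}x {}y exy; rewrite alpha_frac_eq //.
have [tx sx lx] := tree_pairP x; have [ty sy ly] := tree_pairP y.
split=> [/frac_eq [p [q []]]|H]; last first.
  by congr frac; apply: pair_class_eq => //; rewrite exy; exact: forest_eqv_refl.
have [p' ->] := fclass_surj p; have [q' ->] := fclass_surj q.
move: p' q' => {}p {}q rp' rq' H1' H2'.
have rp : root p = leaf (val x).1 by rewrite -root_fclass -leaf_fclass; exact: rp'.
have rq : root q = leaf (val y).1 by rewrite -root_fclass -leaf_fclass; exact: rq'.
have rp2 : root p = leaf (val x).2 by rewrite -lx.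
have rq2 : root q = leaf (val y).2 by rewrite -ly.
have H1 : forest_eqv (comp (val x).1 p) (comp (val y).1 q).
  by apply/fclass_eqP; rewrite -!comp_fclass //; exact: H1'.
(* Cancelling the common denominator shows [p] and [q] equivalent. Hence [q] may be replaced by [p],
   and both fractions grown by the same forest. *)
have pq : forest_eqv p q.
  apply: (@forest_eqv_cancel _ (val x).2); rewrite ?exy -?exy //; first by rewrite exy.
  by apply/fclass_eqP; rewrite -!comp_fclass ?exy -?exy //; [rewrite {2}exy; exact: H2' | rewrite exy].
have [x' ex'] : exists z : tree_pair F, val z = (comp (val x).1 p, comp (val x).2 p).
  by apply: tree_pair_exists; rewrite ?(root_comp th) ?(leaf_comp th).
have rp3 : root p = leaf (val y).1 by rewrite ly -exy.
have [y' ey'] : exists z : tree_pair F, val z = (comp (val y).1 p, comp (val y).2 p).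
  by apply: tree_pair_exists; rewrite ?(root_comp th) ?(leaf_comp th) // -ly.
apply/alpha_frac_eq => //; rewrite -(frac_comp rp ex') -(frac_comp rp3 ey').
apply/alpha_frac_eq; rewrite ex' ey' /= ?exy //.
by apply: forest_eqv_trans H1 _; apply: forest_eqv_compl => //; exact: forest_eqv_sym.
Qed.

(** A fraction [t, s] acting trivially acts like [s, s], so the criterion applied in the quotient
    makes t and s equivalent there, hence already in [F]. *)
Lemma FS_quot_faithful : faithful_action F'.
Proof.
move=> g; have [X ->] := frac_surj g; have [x ->] := pair_class_surj X => H.
have [tx sx lx] := tree_pairP x; have [y ey] := tree_pair_exists sx sx erefl.
have e1 : frac (F := F') (pair_class y) = 1%g.
  by apply: (@frac_oneE F'); rewrite val_pair_class ey.
rewrite -e1; congr frac; apply: pair_class_eq; rewrite ey //=; last exact: forest_eqv_refl.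
have -> : (val x).2 = (val y).1 by rewrite ey.
apply: forest_eqv_fclass.
apply/(@alpha_frac_eq F' (pair_class x) (pair_class y)).
  by rewrite !val_pair_class ey.
by apply/funext => u; rewrite H e1 alpha1.
Qed.

(** One [repr] chooses a group element modulo the kernel of alpha, the other a pair of trees;
    [quot_isoE] shows that the choices do not matter. *)
Definition quot_iso (a : FSgroup_quot F) : FSgroup F' :=
  frac (F := F') (pair_class (repr (repr a))).

Lemma quot_isoE x : quot_iso (gclass (frac x)) = frac (F := F') (pair_class x).
Proof.
apply/frac_pair_class_eqP; rewrite -(repr_gclass (frac x)); congr alpha.
exact: reprK.
Qed.

Lemma quot_isoM : {morph quot_iso : a b / (a * b)%g}.
Proof.
move=> a b; have [g ->] := gclass_surj a; have [h ->] := gclass_surj b.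
have [x [y [-> -> e]]] := frac_common g h.
have [z ez] := frac_mul_pair e.
rewrite [(_ * _)%g in LHS]gclassM [(_ * _)%g in LHS](frac_mulE e ez) !quot_isoE.
by symmetry; apply: frac_mulE; rewrite /= -/(val _) ?e ?ez.
Qed.

Lemma quot_iso_bij : bijective quot_iso.
Proof.
have inj : injective quot_iso.
  move=> a b; have [g ->] := gclass_surj a; have [h ->] := gclass_surj b.
  have [x ->] := frac_surj g; have [y ->] := frac_surj h.
  by rewrite !quot_isoE => /frac_pair_class_eqP H; apply/gclass_eq.
(* The boolean equality makes [xchoose] applicable, which yields the inverse. *)
have surj k : exists a, quot_iso a == k.
  have [X ->] := frac_surj k; have [x ->] := pair_class_surj X.
  by exists (gclass (frac x)); rewrite quot_isoE.
exists (fun k => xchoose (surj k)) => a; last exact/eqP/(xchooseP (surj a)).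
by apply: inj; exact/eqP/(xchooseP (surj _)).
Qed.

HB.instance Definition _ := isMultiplicative.Build _ _ quot_iso quot_isoM.

End QuotientGroup.

Theorem corollary3 (F : OreFScat) :
  exists (hFS : is_FS (FS_quot F)) (hOre : is_Ore (MkFScat hFS)),
    let F' := MkOreFScat hOre in
    faithful_action F' /\
    exists phi : {multiplicative FSgroup_quot F -> FSgroup F'},
      bijective phi /\
      forall x : tree_pair F, phi (gclass (frac x)) = frac (F := F') (pair_class x).
Proof.
exists (FS_quot_presented F), (FS_quot_Ore F); split; first exact: FS_quot_faithful.
by exists (@quot_iso F); split; [exact: quot_iso_bij | exact: quot_isoE].
Qed.
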